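(* Assume $b\neq 0$ and $\int_0\frac{\Phi(u)}{|\Psi(u)|}\,\mathrm{d}u=\infty$ (divergence near $0$). Let $(Y_t,t\ge 0)$ be a CBI$(\Psi,\Phi)$ process. Then for every $x\ge 0$, under $\mathbb P_x$, $$r_t(1/Y_t)\xrightarrow[t\to\infty]{d}\mathrm{e}_1,$$ where $\mathrm{e}_1$ is an exponential random variable with parameter $1$ (with the convention $1/0=\infty$).
   Context: Let $\sigma\ge 0$, $b\in\mathbb R$, $\beta\ge 0$, and let $\pi,\nu$ be $\sigma$-finite measures on $(0,\infty)$ with $\int_0^\infty (z\wedge z^2)\pi(\mathrm{d}z)<\infty$ and $\int_0^\infty(1\wedge z)\nu(\mathrm{d}z)<\infty$. The branching mechanism is $\Psi(q)=bq+\frac12\sigma^2q^2+\int_0^\infty(e^{-qu}-1+qu)\pi(\mathrm{d}u)$ and the immigration mechanism is $\Phi(q)=\beta q+\int_0^\infty(1-e^{-qu})\nu(\mathrm{d}u)$, $q\ge 0$; it is assumed that $\Phi(q)>0$ for all $q>0$. For $\lambda\ge 0$, $t\mapsto v_t(\lambda)$ solves $\frac{\partial}{\partial t}v_t(\lambda)=-\Psi(v_t(\lambda))$, $v_0(\lambda)=\lambda$. A CBI$(\Psi,\Phi)$ process is a $[0,\infty)$-valued Markov process $(Y_t)$ with $\mathbb E_x[e^{-\lambda Y_t}]=\exp\big(-xv_t(\lambda)-r_t(\lambda)\big)$, where $\mathbb P_x,\mathbb E_x$ refer to the process started at $x\ge0$ and $r_t(\lambda):=\int_0^t\Phi(v_s(\lambda))\mathrm{d}s=\int_{v_t(\lambda)}^{\lambda}\frac{\Phi(u)}{\Psi(u)}\mathrm{d}u$.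 Also $r_t(\infty):=\lim_{\lambda\to\infty}r_t(\lambda)\in(0,\infty]$. *)

(* Defs.v *)
From HB Require Import structures.
From mathcomp Require Import all_boot all_order all_algebra.
From mathcomp Require Import all_classical all_reals all_analysis.
Set Implicit Arguments. Unset Strict Implicit. Unset Printing Implicit Defensive.
Import Order.TTheory GRing.Theory Num.Theory.
Import numFieldNormedType.Exports.
Local Open Scope classical_set_scope.
Local Open Scope ring_scope.

Section cbi_defs.
Context {R : realType}.
Local Notation mu := (@lebesgue_measure R).

Definition Rpos : set R := `]0, +oo[.

Definition branching (sigma b : R) (pi : set R -> \bar R) (q : R) : R :=
  b * q + sigma ^+ 2 * q ^+ 2 / 2
  + fine (\int[pi]_(u in Rpos) (expR (- (q * u)) - 1 + q * u)%:E)%E.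

Definition immigration (beta : R) (nu : set R -> \bar R) (q : R) : R :=
  beta * q + fine (\int[nu]_(u in Rpos) (1 - expR (- (q * u)))%:E)%E.

Definition solves_v (Psi : R -> R) (v : R -> R -> R) : Prop :=
  forall lam, 0 <= lam ->
    [/\ v 0 lam = lam,
        (forall t : R, 0 <= t -> 0 <= v t lam),
        {within `[0, +oo[, continuous (fun t => v t lam)} &
        (forall t : R, 0 < t -> is_derive t 1 (fun s => v s lam) (- Psi (v t lam)))].

Definition r_fun (Phi : R -> R) (v : R -> R -> R) (t lam : R) : R :=
  fine (\int[mu]_(s in `[0%R, t]) (Phi (v s lam))%:E)%E.

Definition r_inf (Phi : R -> R) (v : R -> R -> R) (t : R) : \bar R :=
  lim ((r_fun Phi v t lam)%:E @[lam --> +oo]).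

Definition r_inv (Phi : R -> R) (v : R -> R -> R) (t y : R) : \bar R :=
  if y == 0 then r_inf Phi v t else (r_fun Phi v t (1 / y))%:E.

(** [Y] is a CBI(Psi,Phi) process started at x on the probability space
    (T, P): a [0,oo)-valued process, Y_0 = x a.s., which is Markov with respect
    to its natural filtration with transition kernels P_t(y, .) determined by
    \int e^{-lambda z} P_t(y, dz) = exp(- y v_t(lambda) - r_t(lambda)), i.e.
    for s, t >= 0, lambda >= 0 and A in sigma(Y_u, u <= s):
    E[1_A e^{-lambda Y_{s+t}}] = E[1_A exp(- Y_s v_t(lambda) - r_t(lambda))]. *)
Definition natural_filtration d (T : measurableType d) (Y : R -> T -> R) (s : R)
  : set (set T) :=
  <<s \bigcup_(u in `[0, s]) preimage_set_system setT (Y u) measurable >>.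

Definition is_CBI d (T : measurableType d) (P : probability T R)
    (Psi Phi : R -> R) (v : R -> R -> R) (x : R) (Y : R -> T -> R) : Prop :=
  [/\ (forall t, 0 <= t -> measurable_fun setT (Y t)),
      (forall t w, 0 <= t -> 0 <= Y t w),
      {ae P, forall w, Y 0 w = x} &
      (forall s t lam A, 0 <= s -> 0 <= t -> 0 <= lam ->
         natural_filtration Y s A ->
         (\int[P]_(w in A) (expR (- (lam * Y (s + t) w)))%:E
          = \int[P]_(w in A)
              (expR (- (Y s w * v t lam) - r_fun Phi v t lam))%:E)%E)].

Definition cvg_in_distribution d (T : measurableType d) (P : probability T R)
    (X : R -> T -> \bar R) (Q : set R -> \bar R) : Prop :=
  forall s : R, {for s, continuous (fun y : R => fine (Q `]-oo, y]%classic))} ->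
    (P [set w | (X t w <= s%:E)%E] @[t --> +oo] --> Q `]-oo, s]%classic).

End cbi_defs.

(* Main.v *)
Require Import Defs.
From HB Require Import structures.
From mathcomp Require Import all_boot all_order all_algebra.
From mathcomp Require Import all_classical all_reals all_analysis.
From mathcomp Require Import measurable_realfun ring lra.
(** Fix [s > 0].  For large [t] choose [lam] with [r_t(lam) <= s < r_t(2 lam)].
    Then [{1 <= lam Y_t}] is contained in [{r_t(1/Y_t) <= s}], which is contained in
    [{1 < 2 lam Y_t}], so it is enough that [E exp(- theta lam Y_t)] tends to
    [exp(- s)] for every [theta > 0]: then [lam Y_t] is close to [0] with
    probability about [exp(- s)] and huge otherwise.  This Laplace transform is
    [exp(- x v_t(theta lam) - r_t(theta lam))], so one needs [v_t(theta lam) -> 0]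
    and [r_t(theta lam) - r_t(lam) -> 0].

    Since [Psi(q) - b q] is nondecreasing and [o(q)] at [0], solutions of
    [y' = - Psi(y)] compare with each other and with exponentials.  Hence replacing
    [lam] by [theta lam] is absorbed by a time shift of bounded length [tau], which
    changes [r_t] by at most [tau] times a value of [Phi] near [0].  The divergence
    of the integral of [Phi / |Psi|] at [0] is used through the geometric sums
    [\sum_n Phi(eps exp(- c n)) = +oo].  For [b > 0] they bound [r_t(lam)] from below,
    so that [lam -> 0].  For [b < 0], [v_(t-u)(lam) >= v_t(lam) exp(b u)] gives
    [r_t(lam) >= \sum_(n < t) Phi(v_t(lam) exp(b (n + 1)))], so that [r_t(lam) <= s]
    forces [v_t(lam) -> 0]. *)

Set Implicit Arguments. Unset Strict Implicit. Unset Printing Implicit Defensive.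
Import Order.TTheory GRing.Theory Num.Theory.
Import numFieldNormedType.Exports.
Local Open Scope classical_set_scope.
Local Open Scope ring_scope.

(** * Differential inequalities *)

Section ode.
Context {R : realType}.
Implicit Types (f g D : R -> R) (t T c : R).

(** A one-sided Gronwall argument. Let [t0] be the last time in [[0, T]] with [D <= 0]. If [t0 < T],
    then [D > 0] after [t0], so [D(t) exp(- c t)] is nonincreasing from there, yet it starts at a
    value at most [0]. The differential inequality is therefore asked for only where [D > 0]. *)
Lemma le0_of_derive_le D dD c T : 0 <= T ->
  D x @[x --> 0^'+] --> D 0 ->
  (forall t, 0 < t <= T -> is_derive t 1 D (dD t)) ->
  (forall t, 0 < t < T -> 0 < D t -> dD t <= c * D t) ->
  D 0 <= 0 -> D T <= 0.
Proof.
move=> T0 D0c dDP dDle D00; rewrite leNgt; apply/negP => DT.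
pose A := [set t | 0 <= t <= T /\ D t <= 0].
have A0 : A 0 by split=> //; rewrite lexx.
have supA : has_sup A by split; [exists 0|exists T => t [/andP[]]].
pose t0 := sup A.
have t0ge : 0 <= t0 by apply: ub_le_sup => //; case: supA.
have t0le : t0 <= T by apply: ge_sup; [exists 0|move=> t [/andP[]]].
have contD t : 0 < t <= T -> {for t, continuous D}.
  by move=> /dDP ?; apply/differentiable_continuous/derivable1_diffP.
(* Otherwise [D] would be positive on a neighbourhood of [t0], and [t0] could not be a limit of
   points of [A]. *)
have Dt0 : D t0 <= 0.
  rewrite leNgt; apply/negP => Dt0.
  have t0gt : 0 < t0.
    by rewrite lt_neqAle t0ge andbT; apply/eqP => E; move: Dt0; rewrite -E ltNge D00.
  have /contD/cvgr_gt/(_ _ Dt0) : 0 < t0 <= T by rewrite t0gt.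
  case=> e /= e0 He.
  have [s As ts] := sup_adherent e0 supA.
  have [_ Ds] := As.
  have st0 : s <= t0 by apply: ub_le_sup => //; case: supA.
  suff : 0 < D s by rewrite ltNge Ds.
  by apply: He; rewrite /ball/= ger0_norm ?subr_ge0// ltrBlDr -ltrBlDl.
have t0lt : t0 < T.
  by rewrite lt_neqAle t0le andbT; apply/eqP => E; move: DT; rewrite -E ltNge Dt0.
have Dpos t : t0 < t <= T -> 0 < D t.
  move=> /andP[t0t tT]; rewrite ltNge; apply/negP => Dt.
  have : t <= t0.
    by apply: ub_le_sup; [case: supA|split=> //; rewrite tT (le_trans t0ge)// ltW].
  by rewrite leNgt t0t.
pose E t := D t * expR (- c * t).
have dE t : t0 < t <= T -> is_derive t 1 E (expR (- c * t) * (dD t - c * D t)).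
  move=> /andP[t0t tT]; rewrite /E.
  have dDt : is_derive t 1 D (dD t) by apply: dDP; rewrite tT (le_lt_trans t0ge).
  apply: is_derive_eq; rewrite /GRing.scale/= !mulr1; ring.
have Ec : {within `[t0, T], continuous E}.
  apply/continuous_within_itvP => //; split.
  - move=> t; rewrite in_itv/= => /andP[t0t tT].
    apply/differentiable_continuous/derivable1_diffP.
    by have [] := @dE t; rewrite ?t0t ?(ltW tT).
  - apply: cvgM; last first.
      apply: cvg_at_right_filter; apply: (@continuous_comp _ _ _ ( *%R (- c))).
        exact: mulrl_continuous.
      exact: continuous_expR.
    (* At time [0] only the right limit of [D] is given; at a positive [t0] continuity follows from
       the derivative. *)
    have [E0|t0gt] := eqVneq t0 0; first by rewrite E0.
    by apply: cvg_at_right_filter; apply: contD; rewrite t0le lt_neqAle eq_sym t0gt t0ge.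
  - apply: cvg_at_left_filter; apply/differentiable_continuous/derivable1_diffP.
    by have [] := @dE T; rewrite ?t0lt ?lexx.
have : E T <= E t0.
  have L := @ler0_derive1_le_cc R E t0 T _ _ Ec.
  apply: L => //; rewrite ?in_itv/= ?lexx ?t0le//.
  - move=> t; rewrite in_itv/= => /andP[t0t tT].
    by have [] := @dE t; rewrite ?t0t ?(ltW tT).
  - move=> t; rewrite in_itv/= => /andP[t0t tT]; rewrite derive1E.
    have /dE ? : t0 < t <= T by rewrite t0t ltW.
    rewrite derive_val pmulr_rle0 ?expR_gt0// subr_le0 dDle//.
      by rewrite (le_lt_trans t0ge t0t) tT.
    by rewrite Dpos// t0t ltW.
rewrite leNgt => /negP; apply; rewrite /E.
apply: (@le_lt_trans _ _ 0); first by rewrite pmulr_lle0 ?expR_gt0.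
by rewrite mulr_gt0 ?expR_gt0.
Qed.

End ode.

(** * Comparison of solutions of [y' = - Psi(y)] *)

Section solutions.
Context {R : realType} (Psi : R -> R) (b : R).
Implicit Types (f g : R -> R) (a x y q s t T c delta tau m M : R).

(** A property of a single function with free initial value, so that time shifts of [v^~ lam]
    satisfy it as well; they stand in for the semigroup property of the flow. *)
Definition solution f : Prop :=
  [/\ f x @[x --> 0^'+] --> f 0, forall t, 0 <= t -> 0 <= f t &
      forall t, 0 < t -> is_derive t 1 f (- Psi (f t))].

Hypothesis Psi_incr : forall x y, 0 <= x -> x <= y -> b * (y - x) <= Psi y - Psi x.
Hypothesis Psi0 : Psi 0 = 0.

Lemma solution_shift f tau : 0 <= tau -> solution f ->
  solution (fun t => f (t + tau)).
Proof.
move=> tau0 [f0 fge0 df]; split.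
- have [->|tau_neq0] := eqVneq tau 0.
    by rewrite addr0; under eq_fun do rewrite addr0.
  apply: cvg_at_right_filter.
  apply: (@continuous_comp _ _ _ (fun t => t + tau) f 0).
    by apply: cvgD; [exact: cvg_id|exact: cvg_cst].
  rewrite add0r; apply/differentiable_continuous/derivable1_diffP.
  by have [] := df tau _; rewrite // lt_neqAle eq_sym tau_neq0.
- by move=> t t0; rewrite fge0// addr_ge0.
- move=> t t0; have ? := df (t + tau) (ltr_wpDr tau0 t0).
  have ? : is_derive t 1 (fun s : R => s + tau) 1.
    by apply: is_derive_eq; rewrite addr0.
  by apply: is_derive_eq; rewrite mulr1.
Qed.

(** Where [f > g], [Psi_incr] gives [(f - g)' <= - b (f - g)]. *)
Lemma solution_le f g t : solution f -> solution g -> f 0 <= g 0 -> 0 <= t ->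
  f t <= g t.
Proof.
move=> [f0 fge0 df] [g0 gge0 dg] fg0 t0; rewrite -subr_le0.
apply: (@le0_of_derive_le _ (fun s => f s - g s)
  (fun s => - Psi (f s) + Psi (g s)) (- b)) => //.
- exact: cvgB.
- move=> s /andP[s0 _]; have ? := df s s0; have ? := dg s s0.
  by apply: is_derive_eq; rewrite opprK.
- move=> s /andP[s0 _]; rewrite subr_gt0 => gf.
  have := Psi_incr (gge0 s (ltW s0)) (ltW gf); lra.
- by rewrite subr_le0.
Qed.

Lemma is_derive_exp_scaled (k c s : R) :
  is_derive s 1 (fun t => k * expR (c * t)) (c * (k * expR (c * s))).
Proof. by apply: is_derive_eq; rewrite /GRing.scale/= !mulr1; ring. Qed.

Lemma cvg_exp_scaled (k c s : R) :
  k * expR (c * t) @[t --> s^'+] --> k * expR (c * s).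
Proof.
have : {for s, continuous (fun t => k * expR (c * t))}.
  apply/differentiable_continuous/derivable1_diffP.
  by have [] := is_derive_exp_scaled k c s.
exact: cvg_at_right_filter.
Qed.

Lemma solution_le_exp f t : solution f -> 0 <= t ->
  f t <= f 0 * expR (- b * t).
Proof.
move=> [f0 fge0 df] t0; rewrite -subr_le0.
apply: (@le0_of_derive_le _ (fun s => f s - f 0 * expR (- b * s))
  (fun s => - Psi (f s) - (- b * (f 0 * expR (- b * s)))) (- b)) => //.
- by apply: cvgB => //; exact: cvg_exp_scaled.
- move=> s /andP[s0 _]; have ? := df s s0.
  by have ? := is_derive_exp_scaled (f 0) (- b) s; exact: is_derive_eq.
- move=> s /andP[s0 _] _.
  have := Psi_incr (lexx 0) (fge0 _ (ltW s0)); rewrite Psi0; lra.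
- by rewrite mulr0 expR0; lra.
Qed.

(** The bound [Psi q <= c q] holds only up to [delta]. Where [f] lies below the exponential, and the
    exponential below [delta], it applies to [f]. *)
Lemma solution_ge_exp f t c delta : solution f -> 0 <= t ->
  (forall q, 0 <= q -> q <= delta -> Psi q <= c * q) ->
  (forall s, 0 <= s -> s <= t -> f 0 * expR (- c * s) <= delta) ->
  f 0 * expR (- c * t) <= f t.
Proof.
move=> [f0 fge0 df] t0 Psi_le fdelta; rewrite -subr_le0.
apply: (@le0_of_derive_le _ (fun s => f 0 * expR (- c * s) - f s)
  (fun s => - c * (f 0 * expR (- c * s)) + Psi (f s)) (- c) t t0).
- by apply: cvgB => //; exact: cvg_exp_scaled.
- move=> s /andP[s0 _]; have ? := df s s0.
  have ? := is_derive_exp_scaled (f 0) (- c) s.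
  by apply: is_derive_eq; rewrite opprK.
- move=> s /andP[s0 st]; rewrite subr_gt0 => fs.
  have := Psi_le _ (fge0 _ (ltW s0)) (le_trans (ltW fs) (fdelta _ (ltW s0) (ltW st))).
  lra.
- by rewrite mulr0 expR0; lra.
Qed.

End solutions.

(** * Integrals of Phi along solutions *)

Section translation.
Context {R : realType}.
Local Notation mu := (@lebesgue_measure R).
Local Open Scope ereal_scope.

Let shift (tau : R) : measurableTypeR R -> measurableTypeR R :=
  fun x => (x + tau)%R.

Let measurable_shift tau : measurable_fun setT (shift tau).
Proof. exact: measurable_funD. Qed.

Lemma shift_preimage_itv (tau : R) ba (x : R) bb (y : R) :
  (fun s => s + tau)%R @^-1` [set` Interval (BSide ba x) (BSide bb y)] =
  [set` Interval (BSide ba (x - tau)%R) (BSide bb (y - tau)%R)].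
Proof.
apply/seteqP; split=> s /=; rewrite !itv_boundlr/=;
  case: ba; case: bb; rewrite !bnd_simp ?lerBlDr ?lerBrDr ?ltrBlDr ?ltrBrDr//.
Qed.

Lemma lebesgue_measure_translation (tau : R) (A : set R) : measurable A ->
  pushforward mu (shift tau) A = mu A.
Proof.
move=> mA.
apply/esym/lebesgue_measure_unique => //= _ [[x y]] _ <-.
rewrite /pushforward shift_preimage_itv/= !lebesgue_measure_itv/=.
rewrite !lte_fin ltrD2r; case: ifPn => // _.
by rewrite -!EFinB; congr (_%:E); ring.
Qed.

Lemma ge0_integral_translation (f : R -> \bar R) (tau a b : R) :
  measurable_fun `[a, b] f -> (forall x, x \in `[a, b]%R -> 0 <= f x) ->
  \int[mu]_(x in `[(a - tau)%R, (b - tau)%R]) f (x + tau)%R =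
  \int[mu]_(x in `[a, b]) f x.
Proof.
move=> mf f0; rewrite -(shift_preimage_itv tau true a false b).
have -> : \int[mu]_(x in `[a, b]) f x
        = \int[pushforward mu (shift tau)]_(x in `[a, b]) f x.
  apply: eq_measure_integral => A mA _; exact/esym/lebesgue_measure_translation.
rewrite ge0_integral_pushforward// => x; rewrite inE; exact: f0.
Qed.

End translation.

Section occupation.
Context {R : realType} (Psi Phi : R -> R) (b : R).
Implicit Types (f g : R -> R) (a x y q s t T c delta tau m M : R).
Local Notation mu := (@lebesgue_measure R).

Hypothesis Psi_incr : forall x y, 0 <= x -> x <= y -> b * (y - x) <= Psi y - Psi x.
Hypothesis Psi0 : Psi 0 = 0.
Hypothesis Phi_ge0 : forall x, 0 <= x -> 0 <= Phi x.
Hypothesis Phi_le : forall x y, 0 <= x -> x <= y -> Phi x <= Phi y.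

(** For [f = v^~ lam] this is [r_t(lam)]; a general [f] allows shifted solutions. *)
Definition occupation f t : R := fine (\int[mu]_(s in `[0%R, t]) (Phi (f s))%:E).

(** [Phi] is monotone on the half-line only: its values at negative arguments are junk. *)
Lemma measurable_Phi (D : set R) : measurable D -> D `<=` `[0, +oo[ ->
  measurable_fun D Phi.
Proof.
move=> mD D0; have Phi_max : {in D, (fun x => Phi (Num.max 0 x)) =1 Phi}.
  by move=> x; rewrite inE => /D0/=; rewrite in_itv/= andbT => x0; rewrite max_r.
have : measurable_fun D (fun x => Phi (Num.max 0 x)).
  apply: nondecreasing_measurable => // x y xy.
  apply: Phi_le; first by rewrite le_max lexx.
  by rewrite ge_max !le_max lexx xy orbT.
exact: eq_measurable_fun.
Qed.

Lemma measurable_Phi_comp f a c : solution Psi f -> 0 <= a ->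
  measurable_fun `[a, c] (fun s => (Phi (f s))%:E).
Proof.
move=> [f0 fge0 df] a0; apply/measurable_EFinP.
have mPhi : measurable_fun (`[0, +oo[ : set R) Phi by exact: measurable_Phi.
have mf : measurable_fun `[a, c] f.
  apply: (@measurable_funS _ _ _ _ (`[0, +oo[%classic : set R)) => //.
    by move=> x /=; rewrite !in_itv/= andbT => /andP[/(le_trans a0)].
  apply: subspace_continuous_measurable_fun => //.
  apply/continuous_within_itvcyP; split => // x; rewrite in_itv/= andbT => x0.
  by apply/differentiable_continuous/derivable1_diffP; have [] := df x x0.
apply: measurable_comp mPhi mf => // _ /= [x xac <-].
rewrite in_itv/= andbT fge0//; move: xac; rewrite in_itv/= => /andP[].
by move=> /(le_trans a0).
Qed.

Lemma Phi_comp_ge0 f s : solution Psi f -> 0 <= s -> (0 <= (Phi (f s))%:E)%E.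
Proof. by move=> [_ fge0 _] s0; rewrite lee_fin Phi_ge0// fge0. Qed.

Lemma integral_Phi_le f t M : solution Psi f -> 0 <= t ->
  (forall s, 0 <= s -> s <= t -> f s <= M) ->
  (\int[mu]_(s in `[0%R, t]) (Phi (f s))%:E <= (t * Phi M)%:E)%E.
Proof.
move=> sf t0 fM; have [_ fge0 _] := sf.
apply: (@le_trans _ _ (\int[mu]_(s in `[0%R, t]) (Phi M)%:E)%E).
  apply: ge0_le_integral => //=.
  - by move=> s; rewrite in_itv/= => /andP[s0 _]; exact: Phi_comp_ge0.
  - exact: measurable_Phi_comp.
  - move=> s; rewrite in_itv/= => /andP[s0 st]; rewrite lee_fin.
    by apply: Phi_le; [exact: fge0|exact: fM].
rewrite integral_cst//= lebesgue_measure_itv/= lte_fin.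
case: ltP => [_|t0']; first by rewrite sube0 -EFinM mulrC.
rewrite mule0 lee_fin mulr_ge0// Phi_ge0//.
exact: le_trans (fge0 0 (lexx 0)) (fM _ (lexx 0) t0).
Qed.

(** On [[0, t]] the solution stays below [f 0 exp(|b| t)], so the integral is finite and [fine]
    loses nothing. *)
Lemma occupation_fin f t : solution Psi f -> 0 <= t ->
  (\int[mu]_(s in `[0%R, t]) (Phi (f s))%:E)%E \is a fin_num.
Proof.
move=> sf t0; rewrite ge0_fin_numE; last first.
  by apply: integral_ge0 => s /=; rewrite in_itv/= => /andP[s0 _]; exact: Phi_comp_ge0.
apply: le_lt_trans (ltry (t * Phi (f 0 * expR (`|b| * t)))).
apply: integral_Phi_le => // s s0 st; apply: le_trans (solution_le_exp Psi_incr Psi0 sf s0) _.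
have [_ fge0 _] := sf.
rewrite ler_wpM2l ?fge0// ler_expR; apply: (@le_trans _ _ (`|b| * s)).
  by rewrite ler_wpM2r// -normrN ler_norm.
by rewrite ler_wpM2l.
Qed.

Lemma occupation_le_const f t M : solution Psi f -> 0 <= t ->
  (forall s, 0 <= s -> s <= t -> f s <= M) -> occupation f t <= t * Phi M.
Proof.
move=> sf t0 fM; rewrite -lee_fin fineK ?occupation_fin//.
exact: integral_Phi_le.
Qed.

Lemma occupation_ge_const f t m : solution Psi f -> 0 <= t -> 0 <= m ->
  (forall s, 0 <= s -> s <= t -> m <= f s) -> t * Phi m <= occupation f t.
Proof.
move=> sf t0 m0 fm; rewrite -lee_fin fineK ?occupation_fin//.
apply: (@le_trans _ _ (\int[mu]_(s in `[0%R, t]) (Phi m)%:E)%E).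
  rewrite integral_cst//= lebesgue_measure_itv/= lte_fin.
  case: ltP => [_|t0']; first by rewrite sube0 -EFinM mulrC.
  by rewrite mule0 lee_fin mulr_le0_ge0// Phi_ge0.
apply: ge0_le_integral => //=.
- by move=> s _; rewrite lee_fin Phi_ge0.
- exact: measurable_Phi_comp.
- move=> s; rewrite in_itv/= => /andP[s0 st]; rewrite lee_fin.
  by apply: Phi_le => //; exact: fm.
Qed.

Lemma occupation_ge0 f t : solution Psi f -> 0 <= t -> 0 <= occupation f t.
Proof.
move=> sf t0; apply: fine_ge0; apply: integral_ge0 => s /=.
by rewrite in_itv/= => /andP[s0 _]; exact: Phi_comp_ge0.
Qed.

Lemma occupation_le f g t : solution Psi f -> solution Psi g -> 0 <= t ->
  (forall s, 0 <= s -> s <= t -> f s <= g s) -> occupation f t <= occupation g t.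
Proof.
move=> sf sg t0 fg; rewrite -lee_fin !fineK ?occupation_fin//.
have [_ fge0 _] := sf.
apply: ge0_le_integral => //=.
- by move=> s; rewrite in_itv/= => /andP[s0 _]; exact: Phi_comp_ge0.
- exact: measurable_Phi_comp.
- exact: measurable_Phi_comp.
- move=> s; rewrite in_itv/= => /andP[s0 st]; rewrite lee_fin.
  by apply: Phi_le; [exact: fge0|exact: fg].
Qed.

(** The interval [[0, t + tau]] is cut at [tau] and the second piece translated back to start at
    [0]. This is how time shifts of the flow act on [r]. *)
Lemma occupationD f t tau : solution Psi f -> 0 <= t -> 0 <= tau ->
  occupation f (t + tau) = occupation f tau + occupation (fun s => f (s + tau)) t.
Proof.
move=> sf t0 tau0; apply: EFin_inj; rewrite EFinD !fineK ?occupation_fin//;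
  [|exact: solution_shift|exact: addr_ge0].
have := @ge0_integral_translation R (fun s => (Phi (f s))%:E) tau tau (t + tau).
rewrite subrr addrK => ->; last 2 first.
- exact: measurable_Phi_comp.
- by move=> s; rewrite in_itv/= => /andP[/(le_trans tau0) s0 _]; exact: Phi_comp_ge0.
rewrite [X in (_ + X)%E](_ : _ =
    \int[mu]_(s in `]tau, (t + tau)%R]) (Phi (f s))%:E)%E; last first.
  rewrite integral_itv_obnd_cbnd//.
  apply: (@measurable_funS _ _ _ _ (`[tau, t + tau]%classic : set R)) => //.
    by apply: subset_itvr; rewrite bnd_simp.
  exact: measurable_Phi_comp.
have E : `[0, t + tau]%classic = `[0, tau] `|` `]tau, t + tau] :> set R.
  by rewrite -itv_bndbnd_setU// bnd_simp// lerDr.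
rewrite E ge0_integral_setU//.
- by rewrite -E; exact: measurable_Phi_comp.
- by rewrite -E => s /=; rewrite in_itv/= => /andP[s0 _]; exact: Phi_comp_ge0.
- apply/disj_setPS => s /= []; rewrite !in_itv/= => /andP[_ st] /andP[ts _].
  by move: (lt_le_trans ts st); rewrite ltxx.
Qed.

Lemma occupation_nondecreasing f t tau : solution Psi f -> 0 <= t -> t <= tau ->
  occupation f t <= occupation f tau.
Proof.
move=> sf t0 ttau; rewrite -[tau](subrK t) occupationD// ?subr_ge0// lerDl.
by apply: occupation_ge0; rewrite ?subr_ge0//; exact: solution_shift.
Qed.

End occupation.

(** * From the divergent integral of [Phi / |Psi|] to divergent geometric sums *)

Section divergence.
Context {R : realType} (Psi Phi : R -> R).
Implicit Types (u x y c k rho delta eps M : R).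
Local Notation mu := (@lebesgue_measure R).

Hypothesis Phi_ge0 : forall x, 0 <= x -> 0 <= Phi x.
Hypothesis Phi_le : forall x y, 0 <= x -> x <= y -> Phi x <= Phi y.
Hypothesis mPsi : measurable_fun (`]0, +oo[ : set R) Psi.
Hypothesis Phi_Psi_infty : forall eps, 0 < eps ->
  (\int[mu]_(u in `]0%R, eps[) (Phi u / `|Psi u|)%:E = +oo)%E.

Lemma measurable_Phi_div_Psi (D : set R) : measurable D -> D `<=` `]0, +oo[ ->
  measurable_fun D (fun u => (Phi u / `|Psi u|)%:E).
Proof.
move=> mD D0; apply/measurable_EFinP; apply: measurable_funM.
  apply: measurable_Phi => // x /D0 /=.
  by rewrite !in_itv/= !andbT => /ltW.
have mPsiD : measurable_fun D Psi.
  exact: (@measurable_funS _ _ _ _ (`]0, +oo[%classic : set R)).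
(* The inverse is written as a real power, whose measurability is known. *)
rewrite (_ : (fun _ => _) = (fun u => `|Psi u| `^ (-1))); last first.
  by apply/funext => u; rewrite powR_inv1.
have mnorm : measurable_fun D (fun u => `|Psi u|) by exact: measurableT_comp.
exact: measurableT_comp (measurable_powR (-1)) mnorm.
Qed.

(** On each interval of ratio [exp c], [Phi] is bounded by its value at the right
    end and [1 / |Psi|] by [1 / (k x)], [x] being the left end. *)
Lemma integral_Phi_div_Psi_le k delta c n : 0 < k -> 0 < delta -> 0 < c ->
  (forall u, 0 < u -> u <= delta -> k * u <= `|Psi u|) ->
  (\int[mu]_(u in `[(delta * expR (- c * n%:R))%R, delta[) (Phi u / `|Psi u|)%:E
   <= ((expR c - 1) / k * \sum_(i < n) Phi (delta * expR (- c * i%:R)))%:E)%E.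
Proof.
move=> k0 delta0 c0 Psi_ge; elim: n => [|n IHn].
  by rewrite big_ord0 mulr0 mulr0 expR0 mulr1 set_itvco0 integral_set0.
set x := delta * expR (- c * n.+1%:R); set y := delta * expR (- c * n%:R).
have x0 : 0 < x by rewrite mulr_gt0// expR_gt0.
have y0 : 0 < y by rewrite mulr_gt0// expR_gt0.
have yx : y = x * expR c.
  by rewrite /x /y -mulrA -expRD; congr (_ * expR _); rewrite -natr1; ring.
have ydelta : y <= delta.
  by rewrite /y ger_pMr// -expR0 ler_expR mulNr oppr_le0 mulr_ge0// ltW.
have xy : x < y by rewrite yx ltr_pMr// -expR0 ltr_expR.
have E : `[x, delta[%classic = `[x, y[ `|` `[y, delta[ :> set R.
  by rewrite -itv_bndbnd_setU// bnd_simp// ltW.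
rewrite E ge0_integral_setU//; last 3 first.
- rewrite -E; apply: measurable_Phi_div_Psi => // u /=.
  by rewrite !in_itv/= andbT => /andP[/(lt_le_trans x0)].
- rewrite -E => u /=; rewrite in_itv/= => /andP[xu _].
  by rewrite lee_fin divr_ge0// Phi_ge0// ltW// (lt_le_trans x0).
- apply/disj_setPS => u /= []; rewrite !in_itv/= => /andP[_ uy] /andP[yu _].
  by move: (lt_le_trans uy yu); rewrite ltxx.
rewrite big_ord_recr/= mulrDr EFinD addeC leeD//.
apply: (@le_trans _ _ (\int[mu]_(u in `[x, y[) (Phi y / (k * x))%:E)%E).
  apply: ge0_le_integral => //=.
  - move=> u; rewrite in_itv/= => /andP[xu _].
    by rewrite lee_fin divr_ge0// Phi_ge0// ltW// (lt_le_trans x0).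
  - apply: measurable_Phi_div_Psi => // u /=.
    by rewrite !in_itv/= andbT => /andP[/(lt_le_trans x0)].
  - move=> u; rewrite in_itv/= => /andP[xu uy]; rewrite lee_fin.
    have u0 := lt_le_trans x0 xu.
    have kx : k * x <= `|Psi u|.
      apply: le_trans (Psi_ge u u0 (le_trans (ltW uy) ydelta)).
      by rewrite ler_pM2l.
    have kx0 : 0 < k * x by rewrite mulr_gt0.
    apply: ler_pM.
    + by rewrite Phi_ge0// ltW.
    + by rewrite invr_ge0.
    + by apply: Phi_le; exact: ltW.
    + by rewrite lef_pV2 ?posrE// (lt_le_trans kx0).
rewrite integral_cst//= lebesgue_measure_itv/= lte_fin xy -EFinB -EFinM lee_fin.
rewrite -/y [X in _ <= X](_ : _ = Phi y / (k * x) * (y - x))//.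
(* The interval has length [x (exp c - 1)], so [x] cancels. *)
rewrite yx; field; rewrite ?gt_eqF//.
Qed.

(** The intervals [[delta exp(- c n), delta[] increase to []0, delta[], so by monotone convergence
    the integrals over them are unbounded; each is a constant times a partial sum, at most. *)
Lemma sum_Phi_exp_diverges k rho c eps M : 0 < k -> 0 < rho -> 0 < c -> 0 < eps ->
  (forall u, 0 < u -> u <= rho -> k * u <= `|Psi u|) ->
  exists n, M < \sum_(i < n) Phi (eps * expR (- c * i.+1%:R)).
Proof.
move=> k0 rho0 c0 eps0 Psi_ge.
(* The factor [exp(- c)] moves the index from [i] in the integral bound to [i.+1] in the
   conclusion. *)
pose delta := Num.min rho (eps * expR (- c)).
have delta0 : 0 < delta by rewrite lt_min rho0 mulr_gt0// expR_gt0.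
pose F n : set R := `[delta * expR (- c * n%:R), delta[%classic.
have F0 n u : F n u -> 0 < u.
  by rewrite /F/= in_itv/= => /andP[+ _]; apply: lt_le_trans; rewrite mulr_gt0// expR_gt0.
have UF : \bigcup_n F n = `]0, delta[%classic.
  apply/seteqP; split=> u /=.
    move=> [n _ Fnu]; rewrite in_itv/= (F0 _ _ Fnu).
    by move: Fnu; rewrite /F/= in_itv/= => /andP[].
  rewrite in_itv/= => /andP[u0 udelta].
  (* This [n] makes [delta exp(- c n) <= u]. *)
  have [n nu] : exists n, ln (delta / u) / c < n%:R.
    exists (Num.trunc (ln (delta / u) / c)).+1; exact: truncnS_gt.
  exists n => //; rewrite /F/= in_itv/= udelta andbT.
  have : delta / u <= expR (c * n%:R).
    rewrite -[X in X <= _]lnK ?posrE ?divr_gt0// ler_expR.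
    by rewrite [c * _]mulrC -ler_pdivrMr// ltW.
  by rewrite ler_pdivrMr// mulNr expRN ler_pdivrMr ?expR_gt0// [u * _]mulrC.
have : (\int[mu]_(u in F n) (Phi u / `|Psi u|)%:E)%E @[n --> \oo] --> +oo%E.
  rewrite -(Phi_Psi_infty delta0) -UF; apply: ge0_nondecreasing_set_cvg_integral.
  - move=> n m nm; rewrite subsetEset; apply: subset_itvr; rewrite bnd_simp.
    by rewrite ler_pM2l// ler_expR !mulNr lerN2 ler_pM2l// ler_nat.
  - by move=> n; exact: measurable_itv.
  - move=> n; apply: measurable_Phi_div_Psi; first exact: measurable_itv.
    by move=> u /F0 u0; rewrite /= in_itv/= u0.
  - by move=> n u /F0 /ltW u0; rewrite lee_fin divr_ge0// Phi_ge0.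
pose C := (expR c - 1) / k.
have C0 : 0 < C by rewrite divr_gt0// subr_gt0 -expR0 ltr_expR.
move=> /cvgeyPgt /(_ (C * M)) [n _ /(_ n (leqnn n)) Mn]; exists n.
have Psi_ge' u : 0 < u -> u <= delta -> k * u <= `|Psi u|.
  by move=> u0; rewrite le_min => /andP[urho _]; exact: Psi_ge.
have := lt_le_trans Mn (integral_Phi_div_Psi_le n k0 delta0 c0 Psi_ge').
rewrite lte_fin ltr_pM2l// => /lt_le_trans; apply; apply: ler_sum => i _.
apply: Phi_le; first by rewrite mulr_ge0 ?expR_ge0// ltW.
apply: (@le_trans _ _ ((eps * expR (- c)) * expR (- c * i%:R))).
  by rewrite ler_wpM2r ?expR_ge0// ge_min lexx orbT.
by rewrite -mulrA -expRD le_eqVlt -natr1 mulrDr mulr1 addrC eqxx.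
Qed.

End divergence.

(** * Laplace transforms *)

Section laplace_tails.
Context d {T : measurableType d} {R : realType} (P : probability T R).
Variables (Z : T -> R) (theta l : R).
Hypothesis mZ : measurable_fun setT Z.
Hypothesis Z0 : forall w, 0 <= Z w.
Hypothesis theta0 : 0 <= theta.
Hypothesis Z_laplace : (\int[P]_w (expR (- (theta * Z w)))%:E = l%:E)%E.

Let measurable_expZ : measurable_fun setT (fun w => (expR (- (theta * Z w)))%:E).
Proof.
apply/measurable_EFinP; apply: measurableT_comp => //.
by apply: measurableT_comp => //; exact: measurable_funM.
Qed.

Let measurable_ge1 : measurable [set w | 1 <= Z w].
Proof.
rewrite (_ : [set _ | _] = Z @^-1` `[1, +oo[).
  by rewrite -[X in measurable X]setTI; exact: mZ.
by apply/seteqP; split=> w /=; rewrite in_itv/= andbT.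
Qed.

Let measurable_gt1 : measurable [set w | 1 < Z w].
Proof.
rewrite (_ : [set _ | _] = Z @^-1` `]1, +oo[).
  by rewrite -[X in measurable X]setTI; exact: mZ.
by apply/seteqP; split=> w /=; rewrite in_itv/= andbT.
Qed.

(** Markov's inequality: [exp(theta - theta Z) >= 1] where [Z < 1]. It is applied with [theta]
    small. *)
Lemma probability_ge1_laplace :
  ((1 - expR theta * l)%:E <= P [set w | (1 <= Z w)%R])%E.
Proof.
set A := [set w | 1 <= Z w].
have PC : P (~` A) = (1 - P A)%E by exact: probability_setC.
have : (P (~` A) <= (expR theta * l)%:E)%E.
  rewrite EFinM -Z_laplace -ge0_integralZl//.
  rewrite -(setIT (~` A)) -integral_indic//; last exact: measurableC.
  apply: (@ge0_le_integral _ _ _ P setT) => //.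
  - by apply/measurable_EFinP; apply: measurable_indic; exact: measurableC.
  - by apply: measurable_funeM.
  - move=> w _; rewrite -EFinM lee_fin -expRD indicE.
    case: (boolP (w \in _)) => [|_]; last exact: expR_ge0.
    rewrite inE /A/= => /negP; rewrite -ltNge => Zw.
    rewrite -expR0 ler_expR -[X in X - _]mulr1 -mulrBr mulr_ge0//.
    by rewrite subr_ge0 ltW.
have PA : P A = (fine (P A))%:E.
  by rewrite fineK//; exact: fin_num_measure measurable_ge1.
rewrite PC PA; move: (fine (P A)) => p; have -> : (1 - p%:E)%E = (1 - p)%:E by [].
by rewrite !lee_fin; lra.
Qed.

(** [exp(- theta Z)] is at most [1] where [Z <= 1] and at most [exp(- theta)] elsewhere. It is
    applied with [theta] large. *)
Lemma probability_gt1_laplace : (P [set w | (1 < Z w)%R] <= (1 - l + expR (- theta))%:E)%E.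
Proof.
set A := [set w | 1 < Z w].
have PC : P (~` A) = (1 - P A)%E by exact: probability_setC.
have : (l%:E <= P (~` A) + (expR (- theta))%:E)%E.
  rewrite -Z_laplace -(setIT (~` A)) -integral_indic//; last exact: measurableC.
  have <- : (\int[P]_w (expR (- theta))%:E = (expR (- theta))%:E)%E.
    by rewrite integral_cst//= probability_setT mule1.
  have mI : measurable_fun setT (EFin \o \1_(~` A) : T -> \bar R).
    by apply/measurable_EFinP; apply: measurable_indic; exact: measurableC.
  rewrite -ge0_integralD//.
  apply: (@ge0_le_integral _ _ _ P setT) => //.
  - by apply: emeasurable_funD.
  - move=> w _; rewrite -EFinD lee_fin indicE.
    have [Zw|Zw] := leP (Z w) 1.
      rewrite mem_set; last by rewrite /A/= => /lt_le_trans/(_ Zw); rewrite ltxx.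
      apply: ler_wpDr; first exact: expR_ge0.
      by rewrite -expR0 ler_expR oppr_le0 mulr_ge0.
    rewrite memNset; last by rewrite /A/= => /(_ Zw).
    by rewrite add0r ler_expR lerN2 ler_peMr// ltW.
have PA : P A = (fine (P A))%:E.
  by rewrite fineK//; exact: fin_num_measure measurable_gt1.
rewrite PC PA; move: (fine (P A)) => p; have -> : (1 - p%:E)%E = (1 - p)%:E by [].
by rewrite -EFinD !lee_fin; lra.
Qed.

End laplace_tails.
(** The Markov property at time [0] on the whole space, where [Y 0 = x] almost surely. *)
Lemma CBI_laplace {R : realType} d (T : measurableType d) (P : probability T R)
    (Psi Phi : R -> R) (v : R -> R -> R) (x : R) (Y : R -> T -> R) (t lam : R) :
  is_CBI P Psi Phi v x Y -> 0 <= t -> 0 <= lam ->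
  (\int[P]_w (expR (- (lam * Y t w)))%:E =
   (expR (- (x * v t lam) - r_fun Phi v t lam))%:E)%E.
Proof.
move=> [mY _ Y0 markov] t0 lam0; have := markov 0 t lam setT (lexx 0) t0 lam0.
rewrite add0r => -> //; last first.
  by rewrite -setC0; apply: sigma_algebraC; exact: sigma_algebra0.
transitivity (\int[P]_w (expR (- (x * v t lam) - r_fun Phi v t lam))%:E)%E.
  apply: ae_eq_integral => //.
  - apply/measurable_EFinP; apply: measurableT_comp => //.
    apply: measurable_funB => //; apply: measurableT_comp => //.
    by apply: measurable_funM => //; exact: mY.
  - by apply: filterS Y0 => w Yw _; rewrite /= Yw.
by rewrite integral_cst//= probability_setT mule1.
Qed.

Lemma exponential_cdf {R : realType} (s : R) :
  exponential_prob 1 `]-oo, s]%classic = (1 - expR (- Num.max 0 s))%:E.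
Proof.
have -> : exponential_prob 1 `]-oo, s]%classic = exponential_prob 1 (`[0, s]%classic : set R).
  rewrite /exponential_prob.
  transitivity (\int[lebesgue_measure]_(u in `]-oo, s])
      ((fun u : R => (1 * expR (- 1 * u))%:E) \_ `[0%R, +oo[) u)%E.
    by apply: eq_integral => u _; rewrite /exponential_pdf !patchE; case: ifP.
  rewrite -integral_mkcondr; have -> : `]-oo, s] `&` `[0, +oo[ = `[0, s]%classic :> set R.
    apply/seteqP; split=> u /=; rewrite !in_itv/= andbT.
      by move=> [-> ->].
    by move=> /andP[].
  apply: eq_integral => u; rewrite inE/= in_itv/= => /andP[u0 _].
  by rewrite exponential_pdfE.
case: (ltrgtP 0 s) => [s0|s0|<-].
- by rewrite exponential_prob_itv0c// mulN1r.
- rewrite oppr0 expR0 subrr set_itv_ge; last by rewrite bnd_simp -ltNge.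
  by rewrite /exponential_prob integral_set0.
- by rewrite oppr0 expR0 subrr set_itv1 /exponential_prob integral_set1.
Qed.

(** * The flow and slow variation of r *)

Section flow.
Context {R : realType} (Psi Phi : R -> R) (b : R) (v : R -> R -> R).
Implicit Types (f g : R -> R) (u x y q s t c e delta tau eps eta theta lam M : R).
Local Notation mu := (@lebesgue_measure R).
Local Notation r := (r_fun Phi v).

Hypothesis Psi_incr : forall x y, 0 <= x -> x <= y -> b * (y - x) <= Psi y - Psi x.
Hypothesis Psi0 : Psi 0 = 0.
Hypothesis Psi_le : forall e, 0 < e -> exists2 delta, 0 < delta &
  forall q, 0 <= q -> q <= delta -> Psi q <= (b + e) * q.
Hypothesis Phi_le : forall x y, 0 <= x -> x <= y -> Phi x <= Phi y.
Hypothesis Phi_gt0 : forall x, 0 < x -> 0 < Phi x.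
Hypothesis Phi_small : forall e, 0 < e -> exists2 delta, 0 < delta & Phi delta <= e.
Hypothesis Phi0 : Phi 0 = 0.
Hypothesis b_neq0 : b != 0.
Hypothesis v_solves : solves_v Psi v.
Hypothesis Phi_Psi_infty : forall eps, 0 < eps ->
  (\int[mu]_(u in `]0%R, eps[) (Phi u / `|Psi u|)%:E = +oo)%E.

Let Phi_ge0 x : 0 <= x -> 0 <= Phi x.
Proof. by move=> x0; rewrite -Phi0 Phi_le. Qed.

Let v_solution lam : 0 <= lam -> solution Psi (v^~ lam).
Proof.
move=> lam0; have [_ vge0 vc dv] := v_solves lam0; split => //.
by have /continuous_within_itvcyP[] := vc.
Qed.

Let v0 lam : 0 <= lam -> v 0 lam = lam.
Proof. by move=> /v_solves[]. Qed.

Let v_ge0 t lam : 0 <= t -> 0 <= lam -> 0 <= v t lam.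
Proof. by move=> t0 /v_solution[_ + _]; exact. Qed.

Lemma v_le_exp t lam : 0 <= t -> 0 <= lam -> v t lam <= lam * expR (- b * t).
Proof.
move=> t0 lam0; rewrite -{2}(v0 lam0).
exact: (solution_le_exp Psi_incr Psi0 (v_solution lam0) t0).
Qed.

Lemma v_ge_exp t lam c delta : 0 <= t -> 0 <= lam ->
  (forall q, 0 <= q -> q <= delta -> Psi q <= c * q) ->
  (forall s, 0 <= s -> s <= t -> lam * expR (- c * s) <= delta) ->
  lam * expR (- c * t) <= v t lam.
Proof.
move=> t0 lam0 Psi_c lam_delta; rewrite -{1}(v0 lam0).
by apply: (solution_ge_exp (v_solution lam0) t0 Psi_c) => s; rewrite v0//; exact: lam_delta.
Qed.

Lemma v_le t x y : 0 <= t -> 0 <= x -> x <= y -> v t x <= v t y.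
Proof.
move=> t0 x0 xy; have y0 := le_trans x0 xy.
by apply: (solution_le Psi_incr (v_solution x0) (v_solution y0)) => //=; rewrite !v0.
Qed.

Lemma v_shift_le t tau x y : 0 <= t -> 0 <= tau -> 0 <= x -> 0 <= y ->
  v tau x <= y -> v (t + tau) x <= v t y.
Proof.
move=> t0 tau0 x0 y0 xy.
have sx := solution_shift tau0 (v_solution x0).
by apply: (solution_le Psi_incr sx (v_solution y0)) => //=; rewrite add0r v0.
Qed.

Lemma v_le_shift t tau x y : 0 <= t -> 0 <= tau -> 0 <= x -> 0 <= y ->
  y <= v tau x -> v t y <= v (t + tau) x.
Proof.
move=> t0 tau0 x0 y0 xy.
have sx := solution_shift tau0 (v_solution x0).
by apply: (solution_le Psi_incr (v_solution y0) sx) => //=; rewrite add0r v0.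
Qed.

Lemma r_funE t lam : r t lam = occupation Phi (v^~ lam) t. Proof. by []. Qed.

Lemma r_fun_le t x y : 0 <= t -> 0 <= x -> x <= y -> r t x <= r t y.
Proof.
move=> t0 x0 xy; have y0 := le_trans x0 xy.
apply: (occupation_le Psi_incr Psi0 Phi_ge0 Phi_le) => //; [exact: v_solution..|].
by move=> s s0 _; exact: v_le.
Qed.

(** For [b > 0], [Psi u >= b u]. For [b < 0], [Psi_le] with [e = - b / 2] gives
    [Psi u <= b u / 2 < 0] near [0]. *)
Lemma Psi_ge_near0 : exists k delta, [/\ 0 < k, 0 < delta &
  forall u, 0 < u -> u <= delta -> k * u <= `|Psi u|].
Proof.
case: (ltrgtP b 0) (b_neq0) => // [b_lt0|b_gt0] _.
- have [|delta delta0 Psi_le_delta] := Psi_le (e := - b / 2); first lra.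
  exists (- b / 2), delta; split => // [|u u0 udelta]; first lra.
  have := Psi_le_delta u (ltW u0) udelta.
  have : b * u < 0 by rewrite nmulr_rlt0.
  by move=> bu Pu; rewrite ler0_norm; lra.
- exists b, 1; split => // u u0 _; apply: le_trans (ler_norm _).
  by have := Psi_incr (lexx 0) (ltW u0); rewrite Psi0; lra.
Qed.

Lemma sum_Phi_diverges c eps M : 0 < c -> 0 < eps ->
  exists n, M < \sum_(i < n) Phi (eps * expR (- c * i.+1%:R)).
Proof.
move=> c0 eps0; have [k [delta [k0 delta0 Psi_ge]]] := Psi_ge_near0.
have mPsi : measurable_fun (`]0, +oo[ : set R) Psi.
  (* [Psi] may fail to be monotone when [b < 0], but [g] is nondecreasing, hence measurable. *)
  pose g u := Psi u - b * u.
  have mg : measurable_fun (`]0, +oo[ : set R) g.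
    apply: (@measurable_Phi _ g) => //.
      move=> x y x0 xy; have := Psi_incr x0 xy; rewrite /g; lra.
    by move=> x /=; rewrite !in_itv/= !andbT => /ltW.
  rewrite (_ : Psi = g \+ ( *%R b)); last by apply/funext => u/=; rewrite /g subrK.
  by apply: measurable_funD mg _; exact: mulrl_measurable.
exact: (sum_Phi_exp_diverges Phi_ge0 Phi_le mPsi Phi_Psi_infty M k0 delta0 c0 eps0 Psi_ge).
Qed.

(** On [[i, i + 1]] the decreasing lower bound is least at the right end, whence [i.+1]. *)
Lemma occupation_ge_sum f c eps n : solution Psi f -> 0 < c -> 0 <= eps ->
  (forall s, 0 <= s -> eps * expR (- c * s) <= f s) ->
  \sum_(i < n) Phi (eps * expR (- c * i.+1%:R)) <= occupation Phi f n%:R.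
Proof.
move=> sf c0 eps0 fge; elim: n => [|n IHn].
  by rewrite big_ord0; exact: (occupation_ge0 Phi_ge0 sf).
rewrite big_ord_recr/= -natr1 [_ + 1]addrC.
rewrite (occupationD Psi_incr Psi0 Phi_ge0 Phi_le)// lerD//.
rewrite -[Phi _]mul1r; apply: (occupation_ge_const Psi_incr Psi0 Phi_ge0 Phi_le) => //.
- exact: solution_shift.
- by rewrite mulr_ge0// expR_ge0.
- move=> s s0 s1; apply: le_trans (fge _ _); last by rewrite addr_ge0.
  rewrite ler_wpM2l// ler_expR !mulNr lerN2 ler_pM2l//.
  by rewrite lerD2r.
Qed.

(** Read backwards from time [n], the solution loses at most a factor [exp(b)] per
    unit of time. *)
Lemma occupation_ge_sum_rev f eps n : solution Psi f -> b < 0 -> 0 <= eps ->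
  eps <= f n%:R ->
  \sum_(i < n) Phi (eps * expR (- - b * i.+1%:R)) <= occupation Phi f n%:R.
Proof.
move=> + b_lt0 eps0; elim: n f => [|n IHn] f sf fn.
  by rewrite big_ord0; exact: (occupation_ge0 Phi_ge0 sf).
(* The first unit of time pays for the last term, and the solution shifted by [1] for the first [n]
   terms. *)
rewrite big_ord_recr/= -natr1 addrC.
rewrite (occupationD Psi_incr Psi0 Phi_ge0 Phi_le)// lerD//; last first.
  by apply: IHn; [exact: solution_shift|rewrite natr1].
rewrite -[Phi _]mul1r; apply: (occupation_ge_const Psi_incr Psi0 Phi_ge0 Phi_le) => //.
  by rewrite mulr_ge0// expR_ge0.
move=> s s0 s1; have ns : 0 <= n.+1%:R - s.
  by rewrite subr_ge0 (le_trans s1)// ler1n.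
have := solution_le_exp Psi_incr Psi0 (solution_shift s0 sf) ns.
rewrite subrK add0r => /(le_trans fn) epsf.
have : eps * expR (b * (n.+1%:R - s)) <= f s.
  apply: (@le_trans _ _ (f s * expR (- b * (n.+1%:R - s)) * expR (b * (n.+1%:R - s)))).
    by rewrite ler_wpM2r ?expR_ge0.
  by rewrite -mulrA -expRD -mulrDl addNr mul0r expR0 mulr1.
apply: le_trans; rewrite ler_wpM2l// ler_expR opprK ler_nM2l// natr1.
by rewrite gerBl.
Qed.

(** By monotonicity in [lam] a small starting point [x] suffices. If [b < 0], [Psi <= 0] near [0],
    so the flow stays above [x] and [r_t(x) >= t Phi(x)]. If [b > 0], the flow stays above
    [x exp(- 2 b t)] and the geometric sums diverge. *)
Lemma r_fun_infty lam M : 0 < lam ->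
  exists2 T, 0 <= T & forall t, T <= t -> M < r t lam.
Proof.
move=> lam0; case: (ltrgtP b 0) (b_neq0) => // [b_lt0|b_gt0] _.
- have [|delta delta0 Psi_le_delta] := Psi_le (e := - b / 2); first lra.
  pose x := Num.min lam delta.
  have x0 : 0 < x by rewrite lt_min lam0.
  exists (`|M| / Phi x + 1).
    by rewrite addr_ge0// divr_ge0// Phi_ge0// ltW.
  move=> t Tt; have t0 : 0 <= t.
    by apply: le_trans Tt; rewrite addr_ge0// divr_ge0// Phi_ge0// ltW.
  apply: (@lt_le_trans _ _ (r t x)); last first.
    by apply: r_fun_le => //; [exact: ltW|rewrite ge_min lexx].
  apply: (@lt_le_trans _ _ (t * Phi x)).
    rewrite -ltr_pdivrMr ?Phi_gt0//; apply: lt_le_trans Tt.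
    rewrite (@le_lt_trans _ _ (`|M| / Phi x))//; last by rewrite ltrDl.
    by rewrite ler_wpM2r ?ler_norm// invr_ge0 Phi_ge0// ltW.
  apply: (occupation_ge_const Psi_incr Psi0 Phi_ge0 Phi_le) => //.
  + by apply: v_solution; exact: ltW.
  + exact: ltW.
  + move=> s s0 st.
    have := @v_ge_exp s x 0 delta s0 (ltW x0).
    rewrite [in X in _ -> _ -> X]oppr0 mul0r expR0 mulr1; apply.
      move=> q q0 qdelta; rewrite mul0r; apply: le_trans (Psi_le_delta q q0 qdelta) _.
      by rewrite mulr_le0_ge0//; lra.
    by move=> u u0 us; rewrite oppr0 mul0r expR0 mulr1 ge_min lexx orbT.
- have [delta delta0 Psi_le_delta] := Psi_le b_gt0.
  pose x := Num.min lam delta.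
  have x0 : 0 < x by rewrite lt_min lam0.
  have c0 : 0 < b + b by rewrite addr_gt0.
  have [n Mn] := sum_Phi_diverges M c0 x0.
  exists n%:R => // t nt; have t0 : 0 <= t by apply: le_trans nt.
  apply: (@lt_le_trans _ _ (r t x)); last first.
    by apply: r_fun_le => //; [exact: ltW|rewrite ge_min lexx].
  have sx := v_solution (ltW x0).
  apply: lt_le_trans Mn _; apply: (@le_trans _ _ (r n%:R x)); last first.
    exact: (occupation_nondecreasing Psi_incr Psi0 Phi_ge0 Phi_le sx).
  apply: occupation_ge_sum => //; first exact: ltW.
  move=> s s0; apply: (v_ge_exp s0 (ltW x0) Psi_le_delta) => u u0 us.
  apply: (@le_trans _ _ x); last by rewrite ge_min lexx orbT.
  by rewrite ger_pMr// -expR0 ler_expR mulNr oppr_le0 mulr_ge0// ltW.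
Qed.

(** Starting from [delta exp(- |b| t)], the flow stays below [delta] up to time [t]. Dividing [s] by
    [t + 1] covers [t = 0]. *)
Lemma r_fun_small t s : 0 <= t -> 0 < s -> exists2 lam, 0 < lam & r t lam <= s.
Proof.
move=> t0 s0; have t1 : 0 < t + 1 by rewrite ltr_wpDl.
have [|delta delta0 Phidelta] := Phi_small (e := s / (t + 1)); first by rewrite divr_gt0.
pose lam := delta * expR (- (`|b| * t)).
have lam0 : 0 < lam by rewrite mulr_gt0// expR_gt0.
exists lam => //; apply: (@le_trans _ _ (t * Phi delta)).
  apply: (occupation_le_const Psi_incr Psi0 Phi_ge0 Phi_le) => //.
    by apply: v_solution; exact: ltW.
  move=> u u0 ut; apply: le_trans (v_le_exp u0 (ltW lam0)) _.
  rewrite /lam -mulrA -expRD ger_pMr// -expR0 ler_expR.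
  rewrite addrC subr_le0; apply: (@le_trans _ _ (`|b| * u)); last by rewrite ler_wpM2l.
  by rewrite ler_wpM2r// -normrN ler_norm.
apply: (@le_trans _ _ (t * (s / (t + 1)))); first by rewrite ler_wpM2l.
rewrite mulrA ler_pdivrMr// mulrDr mulr1 mulrC lerDl; exact: ltW.
Qed.

(** If [v_t(lam) > eps], the last [n] units of time before [t] alone contribute more than [s] to
    [r_t(lam)]. *)
Lemma v_small s eps : b < 0 -> 0 < eps ->
  exists2 T, 0 <= T & forall t lam, T <= t -> 0 <= lam -> r t lam <= s -> v t lam <= eps.
Proof.
move=> b_lt0 eps0; have [||n sn] := @sum_Phi_diverges (- b) eps s; rewrite ?oppr_gt0//.
exists n%:R => // t lam nt lam0 rs; rewrite leNgt; apply/negP => epsv.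
have tn0 : 0 <= t - n%:R by rewrite subr_ge0.
have sl := solution_shift tn0 (v_solution lam0).
have := occupation_ge_sum_rev (n := n) sl b_lt0 (ltW eps0).
rewrite addrC subrK => /(_ (ltW epsv)) /(lt_le_trans sn).
apply/negP; rewrite -leNgt; apply: le_trans rs.
rewrite r_funE -{2}[t](subrK n%:R) [_ - _ + _]addrC.
rewrite (occupationD Psi_incr Psi0 Phi_ge0 Phi_le)//;
  last exact: v_solution.
by rewrite lerDr; apply: (occupation_ge0 Phi_ge0 (v_solution lam0)).
Qed.

(** For large [t], [r_t(eps) > s], and [r_t] is nondecreasing in [lam]. *)
Lemma small_lam s eps : 0 < eps ->
  exists2 T, 0 <= T & forall t lam, T <= t -> 0 <= lam -> r t lam <= s -> lam <= eps.
Proof.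
move=> eps0; have [T T0 rT] := r_fun_infty s eps0.
exists T => // t lam Tt lam0 rs; rewrite leNgt; apply/negP => epslam.
have := rT t Tt; apply/negP; rewrite -leNgt; apply: le_trans rs.
by apply: r_fun_le; [exact: le_trans Tt|exact: ltW|exact: ltW].
Qed.

Lemma Phi_small_mul tau eta : 0 <= tau -> 0 < eta ->
  exists2 delta, 0 < delta & delta <= eta /\ tau * Phi delta <= eta.
Proof.
move=> tau0 eta0; have tau1 : 0 < tau + 1 by rewrite ltr_wpDl.
have [|delta delta0 Phidelta] := Phi_small (e := eta / (tau + 1)); first by rewrite divr_gt0.
have m0 : 0 < Num.min delta eta by rewrite lt_min delta0.
exists (Num.min delta eta) => //; split; first by rewrite ge_min lexx orbT.
apply: (@le_trans _ _ (tau * (eta / (tau + 1)))).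
  rewrite ler_wpM2l//; apply: le_trans Phidelta.
  by apply: Phi_le; [exact: ltW|rewrite ge_min lexx].
rewrite mulrA ler_pdivrMr// mulrDr mulr1 mulrC lerDl; exact: ltW.
Qed.

(** Multiplying the starting point by [theta] amounts to a time shift [tau] of
    bounded length. *)
Lemma r_fun_slow theta s eta : 1 <= theta -> 0 < eta ->
  exists2 T, 0 <= T & forall t lam, T <= t -> 0 <= lam -> r t lam <= s ->
    r t (theta * lam) <= r t lam + eta /\ v t (theta * lam) <= eta.
Proof.
move=> theta1 eta0; have theta0 : 0 < theta by exact: lt_le_trans theta1.
have lntheta0 : 0 <= ln theta by exact: ln_ge0.
case: (ltrgtP b 0) (b_neq0) => // [b_lt0|b_gt0] _.
- have [|delta delta0 Psi_le_delta] := Psi_le (e := - b / 2); first lra.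
  (* Near [0] solutions grow at rate at least [c], so within time [tau] the flow from [lam] passes
     [theta * lam]. *)
  pose c := - b / 2; have c0 : 0 < c by rewrite /c; lra.
  pose tau := ln theta / c.
  have tau0 : 0 <= tau by rewrite divr_ge0// ltW.
  have [rho rho0 [rho_eta Phirho]] := Phi_small_mul tau0 eta0.
  (* The factor [exp(b tau)] compensates for the growth during the extra time from [t] to
     [t + tau]. *)
  have [|T1 T10 HT1] := @v_small s (rho * expR (b * tau)) b_lt0.
    by rewrite mulr_gt0// expR_gt0.
  (* Then [lam exp(c u)] stays below [delta] for [u <= tau]. *)
  have [|T2 T20 HT2] := @small_lam s (delta / theta); first by rewrite divr_gt0.
  exists (Num.max T1 T2); first by rewrite le_max T10.
  move=> t lam; rewrite ge_max => /andP[T1t T2t] lam0 rs.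
  have t0 := le_trans T10 T1t.
  have lamdelta := HT2 t lam T2t lam0 rs.
  have vt := HT1 t lam T1t lam0 rs.
  have tlam0 : 0 <= theta * lam by rewrite mulr_ge0// ltW.
  have sl := v_solution lam0.
  have vtau : theta * lam <= v tau lam.
    rewrite mulrC -[X in _ * X]lnK// -[ln theta](divfK (lt0r_neq0 c0)) -/tau.
    rewrite [tau * c]mulrC -[in X in expR X](opprK c).
    apply: (v_ge_exp tau0 lam0 (delta := delta)).
      by move=> q q0 qd; apply: le_trans (Psi_le_delta q q0 qd) _; rewrite /c; lra.
    move=> u u0 utau; apply: (@le_trans _ _ (lam * theta)); last by rewrite -ler_pdivlMr.
    rewrite opprK ler_wpM2l// -[X in _ <= X]lnK// ler_expR.
    by rewrite [c * u]mulrC -ler_pdivlMr.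
  have vrho u : 0 <= u -> u <= tau -> v (u + t) lam <= rho.
    move=> u0 utau; have := solution_le_exp Psi_incr Psi0 (solution_shift t0 sl) u0.
    rewrite /= add0r => /le_trans; apply.
    apply: (@le_trans _ _ (rho * expR (b * tau) * expR (- b * u))).
      by rewrite ler_wpM2r ?expR_ge0.
    rewrite -mulrA -expRD ger_pMr// -expR0 ler_expR mulNr -mulrBr.
    by rewrite mulr_le0_ge0 ?subr_ge0// ltW.
  split.
    (* The flow from [theta * lam] is below the shifted one, whose occupation is at most
       [r_(t + tau)(lam)]; this exceeds [r_t(lam)] by at most [tau Phi(rho)]. *)
    apply: (@le_trans _ _ (occupation Phi (fun u => v (u + tau) lam) t)).
      apply: (occupation_le Psi_incr Psi0 Phi_ge0 Phi_le) => //.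
      + exact: v_solution.
      + exact: (solution_shift tau0 sl).
      + by move=> u u0 _; exact: v_le_shift.
    have := occupationD Psi_incr Psi0 Phi_ge0 Phi_le sl t0 tau0.
    rewrite addrC (occupationD Psi_incr Psi0 Phi_ge0 Phi_le)// -r_funE => rE.
    have /= := occupation_le_const Psi_incr Psi0 Phi_ge0 Phi_le
      (solution_shift t0 sl) tau0 vrho.
    have := occupation_ge0 Phi_ge0 sl tau0.
    rewrite /= in rE *; lra.
  apply: (le_trans (v_le_shift t0 tau0 lam0 tlam0 vtau)).
  by rewrite addrC (le_trans (vrho _ _ _)).
(* Here the shift goes the other way: the flow from [theta * lam] falls below [lam] by time [tau],
   and this initial stretch costs at most [tau Phi(rho)]. *)
- pose tau := ln theta / b.
  have tau0 : 0 <= tau by rewrite divr_ge0// ltW.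
  have [rho rho0 [rho_eta Phirho]] := Phi_small_mul tau0 eta0.
  have [|T T0 HT] := @small_lam s (rho / theta); first by rewrite divr_gt0.
  exists T => // t lam Tt lam0 rs; have t0 := le_trans T0 Tt.
  have := HT t lam Tt lam0 rs; rewrite ler_pdivlMr// mulrC => lamrho.
  have tlam0 : 0 <= theta * lam by rewrite mulr_ge0// ltW.
  have st := v_solution tlam0.
  have vrho u : 0 <= u -> v u (theta * lam) <= rho.
    move=> u0; apply: le_trans (v_le_exp u0 tlam0) (le_trans _ lamrho).
    by rewrite ler_piMr// -expR0 ler_expR mulNr oppr_le0 mulr_ge0// ltW.
  have vtau : v tau (theta * lam) <= lam.
    apply: le_trans (v_le_exp tau0 tlam0) _.
    rewrite mulNr [b * tau]mulrC divfK ?gt_eqF// expRN lnK//.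
    by rewrite mulrC mulKf// gt_eqF.
  split; last exact: le_trans (vrho _ t0) rho_eta.
  apply: (@le_trans _ _ (r (t + tau) (theta * lam))).
    by apply: (occupation_nondecreasing Psi_incr Psi0 Phi_ge0 Phi_le st) => //; rewrite lerDl.
  rewrite r_funE (occupationD Psi_incr Psi0 Phi_ge0 Phi_le)// [leRHS]addrC lerD//.
    apply: le_trans Phirho.
    by apply: (occupation_le_const Psi_incr Psi0 Phi_ge0 Phi_le) => // u u0 _; exact: vrho.
  apply: (occupation_le Psi_incr Psi0 Phi_ge0 Phi_le) => //.
  + exact: (solution_shift tau0 st).
  + exact: v_solution.
  + by move=> u u0 _; exact: v_shift_le.
Qed.

Lemma r_fun_gt0 t lam : 0 < t -> 0 < lam -> 0 < r t lam.
Proof.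
(* With this margin the rate [c = b + e] is nonnegative, so the lower exponential decreases and
   never leaves [[0, delta]]. *)
move=> t0 lam0; have e0 : 0 < `|b| + 1 by rewrite ltr_wpDl.
have [delta delta0 Psi_le_delta] := Psi_le e0.
set c := b + (`|b| + 1) in Psi_le_delta.
have c0 : 0 <= c by rewrite /c addrA addr_ge0// -lerBlDl sub0r -normrN ler_norm.
pose x := Num.min lam delta.
have x0 : 0 < x by rewrite lt_min lam0.
have m0 : 0 < x * expR (- c * t) by rewrite mulr_gt0// expR_gt0.
apply: (@lt_le_trans _ _ (t * Phi (x * expR (- c * t)))).
  by rewrite mulr_gt0// Phi_gt0.
apply: (occupation_ge_const Psi_incr Psi0 Phi_ge0 Phi_le); rewrite ?ltW//.
  by apply: v_solution; exact: ltW.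
move=> s s0 st; apply: (@le_trans _ _ (v s x)); last first.
  by apply: v_le => //; [exact: ltW|rewrite ge_min lexx].
apply: le_trans (v_ge_exp s0 (ltW x0) Psi_le_delta _).
  by rewrite ler_wpM2l ?(ltW x0)// ler_expR !mulNr lerN2 ler_wpM2l.
move=> u u0 us; apply: (@le_trans _ _ x); last by rewrite ge_min lexx orbT.
by rewrite ger_pMr// -expR0 ler_expR mulNr oppr_le0 mulr_ge0.
Qed.

Lemma r_fun_le_r_inf t lam : 0 <= t -> 0 <= lam -> ((r t lam)%:E <= r_inf Phi v t)%E.
Proof.
move=> t0 lam0; (* [v t lam'] is unspecified for [lam' < 0], hence the truncation. *)
pose f lam' := (r t (Num.max 0 lam'))%:E.
have f_nd : nondecreasing_fun f.
  move=> x y xy; rewrite lee_fin; apply: r_fun_le => //.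
    by rewrite le_max lexx.
  by rewrite ge_max !le_max lexx xy orbT.
have -> : r_inf Phi v t = ereal_sup (range f).
  apply: cvg_lim => //; apply: cvg_trans (nondecreasing_cvge f_nd).
  apply: near_eq_cvg; apply: filterS (nbhs_pinfty_ge (num_real 0)) => x x0.
  by rewrite /f max_r.
by apply: ereal_sup_ubound; exists lam => //; rewrite /f max_r.
Qed.

Lemma r_inv_le t x y : 0 <= t -> 0 <= x -> x <= y ->
  (r_inv Phi v t y <= r_inv Phi v t x)%E.
Proof.
move=> t0 x0 xy; rewrite /r_inv; have [xeq0|xneq0] := eqVneq x 0.
  have [//|yneq0] := eqVneq y 0.
  by apply: r_fun_le_r_inf => //; rewrite divr_ge0// (le_trans x0).
have x_gt0 : 0 < x by rewrite lt_neqAle eq_sym xneq0.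
have y_gt0 := lt_le_trans x_gt0 xy.
rewrite gt_eqF// lee_fin; apply: r_fun_le => //; first by rewrite divr_ge0// ltW.
by rewrite !div1r lef_pV2.
Qed.

Lemma r_inv_gt0 t y : 0 < t -> 0 <= y -> (0 < r_inv Phi v t y)%E.
Proof.
move=> t0 y0; rewrite /r_inv; case: eqVneq => [_|yneq0].
  apply: lt_le_trans (r_fun_le_r_inf (ltW t0) ler01).
  by rewrite lte_fin r_fun_gt0.
by rewrite lte_fin r_fun_gt0// divr_gt0// lt_neqAle eq_sym yneq0.
Qed.

(** Start from a [lam] with [r_t(lam) <= s] and double it. If [s] were never passed, [small_lam]
    would bound every [2 ^ n * lam] by [1]. *)
Lemma exists_scale s : 0 < s -> exists2 T, 0 <= T & forall t, T <= t ->
  exists lam, [/\ 0 < lam, r t lam <= s & s < r t (2 * lam)].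
Proof.
move=> s0; have [T T0 HT] := small_lam s ltr01.
exists T => // t Tt; have t0 := le_trans T0 Tt.
have [lam lam0 rlam] := r_fun_small t0 s0.
apply: contrapT => nolam.
have r_le n : r t (2 ^+ n * lam) <= s.
  elim: n => [|n IHn]; first by rewrite expr0 mul1r.
  rewrite leNgt exprS -mulrA; apply/negP => sr; apply: nolam.
  by exists (2 ^+ n * lam); split => //; rewrite mulr_gt0// exprn_gt0.
have lam_le n : 2 ^+ n <= lam^-1.
  rewrite -[_^-1]mul1r ler_pdivlMr//; apply: HT Tt _ (r_le n).
  by rewrite mulr_ge0 ?exprn_ge0// ltW.
have [n] : exists n, lam^-1 < n%:R by exists (Num.trunc lam^-1).+1; exact: truncnS_gt.
apply/negP; rewrite -leNgt; apply: le_trans (lam_le n).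
by rewrite -natrX ler_nat ltnW// ltn_expl.
Qed.

Lemma r_inv_cvg_exponential d (T : measurableType d) (P : probability T R)
    (Y : R -> T -> R) x : 0 <= x -> is_CBI P Psi Phi v x Y ->
  cvg_in_distribution P (fun t w => r_inv Phi v t (Y t w)) (exponential_prob 1).
Proof.
move=> x0 CBI s _; have [mY Yge0 _ _] := CBI.
rewrite exponential_cdf.
have [s0|s0] := leP s 0.
  (* For [s <= 0] the event is empty at every [t > 0], since [r_inv] is positive. *)
  rewrite oppr0 expR0 subrr; apply: cvg_near_cst.
  apply: filterS (nbhs_pinfty_gt (num_real 0)) => t t0.
  rewrite (_ : [set _ | _] = set0) ?measure0//; apply/seteqP; split=> // w /=.
  apply/negP; rewrite -ltNge; apply: (@le_lt_trans _ _ 0%E); first by rewrite lee_fin.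
  apply: r_inv_gt0 => //.
  by apply: Yge0; exact: ltW.
pose A t := [set w | (r_inv Phi v t (Y t w) <= s%:E)%E].
have mA t : 0 <= t -> measurable (A t).
  (* Since [r_inv] is nonincreasing on the half-line, [B] is an interval. *)
  move=> t0; pose B := [set y : R | 0 <= y /\ (r_inv Phi v t y <= s%:E)%E].
  have mB : measurable B.
    apply: is_interval_measurable => y1 y2 [y10 ry1] [y20 ry2] z /andP[y1z zy2].
    split; first exact: le_trans y1z.
    apply: le_trans ry1.
    exact: r_inv_le.
  rewrite (_ : A t = Y t @^-1` B).
    by rewrite -[X in measurable X]setTI; exact: mY.
  by apply/seteqP; split=> w; rewrite /A/B/=; [move=> ?; split => //; exact: Yge0|case].
apply/fine_cvgP; split.
  apply: filterS (nbhs_pinfty_ge (num_real 0)) => t t0.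
  by apply: fin_num_measure; exact: mA.
apply/cvgrPdist_le => /= e e0.
(* The constants give [exp(th1 + eta) <= 1 + e], [exp(- th2) <= e / 2] and
   [(x + 1) eta <= e / 2]. *)
pose th1 := Num.min 1 (ln (1 + e) / 2).
have ln0 : 0 < ln (1 + e) by rewrite ln_gt0// ltrDl.
have th10 : 0 < th1 by rewrite lt_min ltr01/= divr_gt0.
pose th2 := 1 + 2 / e.
have th20 : 0 < th2 by rewrite addr_gt0// divr_gt0.
pose eta := Num.min (ln (1 + e) / 2) (e / 2 / (x + 1)).
have x1 : 0 < x + 1 by rewrite ltr_wpDl.
have eta0 : 0 < eta by rewrite lt_min !divr_gt0.
have [T1 T10 scale] := exists_scale s0.
(* Used at [th1 * lam], this ratio reaches [2 * lam], where [r_t] exceeds [s]; hence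
   [r_t(th1 * lam) > s - eta]. *)
have [|T2 T20 slow1] := r_fun_slow (theta := 2 / th1) s _ eta0.
  by rewrite ler_pdivlMr// mul1r (@le_trans _ _ 1)// ?ge_min ?lexx// ler1n.
(* The upper tail bound concerns [2 * lam * Y t] at parameter [th2]. *)
have [|T3 T30 slow2] := r_fun_slow (theta := th2 * 2) s _ eta0.
  by rewrite mulr_ege1// ?ler1n// lerDl divr_ge0// ltW.
apply: filterS (nbhs_pinfty_ge (num_real (Num.max T1 (Num.max T2 T3)))) => t.
rewrite !ge_max => /and3P[T1t T2t T3t]; have t0 := le_trans T10 T1t.
have [lam [lam0 rs sr]] := scale t T1t.
have L th u : 0 <= th -> 0 <= u -> (\int[P]_w (expR (- (th * (u * Y t w))))%:E =
    (expR (- (x * v t (th * u)) - r_fun Phi v t (th * u)))%:E)%E.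
  move=> th0 u0; under eq_integral do rewrite mulrA.
  by apply: CBI_laplace CBI t0 _; exact: mulr_ge0.
have mZ u : measurable_fun setT (fun w => u * Y t w).
  by apply: measurable_funM => //; exact: mY.
have Zge0 u w : 0 <= u -> 0 <= u * Y t w by move=> u0; rewrite mulr_ge0// Yge0.
have measurable_Z u (I : interval R) : measurable [set w | u * Y t w \in I].
  by rewrite -[X in measurable X]setTI; exact: (mZ u measurableT _ (measurable_itv I)).
have fin_A : P (A t) \is a fin_num by apply: fin_num_measure; exact: mA.
have lower : 1 - expR (- s) - e <= fine (P (A t)).
  have tl0 : 0 <= th1 * lam by rewrite mulr_ge0// ltW.
  have tail := probability_ge1_laplace (mZ lam) (ltW th10)
    (L _ _ (ltW th10) (ltW lam0)).
  have sub_A : [set w | 1 <= lam * Y t w] `<=` A t.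
    move=> w /= lY; have Y_gt0 : 0 < Y t w.
      by rewrite -(pmulr_rgt0 _ lam0) (lt_le_trans ltr01).
    rewrite /A /r_inv /= gt_eqF// lee_fin; apply: le_trans rs; apply: r_fun_le => //.
      by rewrite divr_ge0// ltW.
    by rewrite ler_pdivrMr.
  have le_PA : (P [set w | (1 <= lam * Y t w)%R] <= P (A t))%E.
    apply: le_measure => //; rewrite inE; last exact: mA.
    rewrite (_ : [set _ | _] = [set w | lam * Y t w \in `[1, +oo[]).
      exact: measurable_Z.
    by apply/seteqP; split=> w /=; rewrite in_itv/= andbT.
  rewrite -lee_fin fineK//; apply: le_trans le_PA; apply: le_trans tail.
  rewrite lee_fin.
  have r1 : r_fun Phi v t (th1 * lam) <= s.
    apply: le_trans rs; apply: r_fun_le => //.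
    by rewrite ger_pMl// ge_min lexx.
  have [+ _] := slow1 t (th1 * lam) T2t tl0 r1.
  rewrite mulrA divfK ?gt_eqF// => r2.
  have xv : 0 <= x * v t (th1 * lam) by rewrite mulr_ge0// v_ge0.
  have th1_eta : th1 + eta <= ln (1 + e).
    rewrite [leRHS]splitr lerD//; first by rewrite ge_min lexx orbT.
    by rewrite ge_min lexx.
  rewrite -expRD; set l := expR (_ + _).
  (* The right side is [(1 + e) exp(- s)], at most [exp(- s) + e]. *)
  have : l <= expR (ln (1 + e) - s) by rewrite ler_expR; lra.
  rewrite expRD lnK ?posrE ?addr_gt0// mulrDl mul1r.
  have : e * expR (- s) <= e by rewrite ger_pMr// -expR0 ler_expR oppr_le0 ltW.
  lra.
have upper : fine (P (A t)) <= 1 - expR (- s) + e.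
  have lam20 : 0 <= 2 * lam by rewrite mulr_ge0// ltW.
  have tail := probability_gt1_laplace (mZ (2 * lam)) (fun w => Zge0 _ w lam20) (ltW th20)
    (L _ _ (ltW th20) lam20).
  have A_sub : A t `<=` [set w | 1 < 2 * lam * Y t w].
    move=> w; rewrite /A /r_inv /=; case: eqVneq => [_|Yneq0].
      (* If [Y t w = 0], then [r_inv] is [r_inf], at least [r_t(2 * lam) > s], so [w] is not in
         [A t]. *)
      move=> /(le_trans (r_fun_le_r_inf t0 lam20)).
      by rewrite lee_fin leNgt sr.
    have Y_gt0 : 0 < Y t w by rewrite lt_neqAle eq_sym Yneq0 Yge0.
    rewrite lee_fin => rY; rewrite -ltr_pdivrMr// ltNge; apply/negP => lY.
    by have := le_trans (r_fun_le t0 lam20 lY) rY; rewrite leNgt sr.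
  have PA_le : (P (A t) <= P [set w | (1 < 2 * lam * Y t w)%R])%E.
    apply: le_measure => //; rewrite inE; first exact: mA.
    rewrite (_ : [set _ | _] = [set w | 2 * lam * Y t w \in `]1, +oo[]).
      exact: measurable_Z.
    by apply/seteqP; split=> w /=; rewrite in_itv/= andbT.
  rewrite -lee_fin fineK//; apply: le_trans PA_le _; apply: le_trans tail _.
  rewrite lee_fin mulrA.
  have [r2 v2] := slow2 t lam T3t (ltW lam0) rs.
  have xv : x * v t (th2 * 2 * lam) <= x * eta by rewrite ler_wpM2l.
  have xeta : (x + 1) * eta <= e / 2.
    by rewrite mulrC -ler_pdivlMr// ge_min lexx orbT.
  set l := expR (_ - _).
  (* The exponent of [l] is at least [- s - (x + 1) eta]. *)
  have le_l : expR (- s) * expR (- (e / 2)) <= l by rewrite -expRD ler_expR; lra.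
  have := expR_ge1Dx (- (e / 2)).
  have es1 : expR (- s) <= 1 by rewrite -expR0 ler_expR oppr_le0 ltW.
  have es0 := expR_ge0 (- s).
  have th2e : expR (- th2) <= e / 2.
    rewrite expRN -[e / 2]invf_div lef_pV2 ?posrE ?expR_gt0 ?divr_gt0//.
    by apply: le_trans (expR_ge1Dx _); rewrite /th2; lra.
  nra.
by rewrite ler_distlC lower upper.
Qed.

End flow.

(** * Branching and immigration mechanisms *)

Section real_integrals.
Context d {T : measurableType d} {R : realType} (m : {measure set T -> \bar R}).
Context (D : set T) (mD : measurable D).
Implicit Types (f g h k : T -> R).

Let I f : R := fine (\int[m]_(x in D) (f x)%:E)%E.

Lemma fine_integral_le h k g : measurable_fun D h -> measurable_fun D k ->
  measurable_fun D g -> (forall x, D x -> 0 <= h x <= k x) ->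
  (forall x, D x -> k x <= g x) ->
  (\int[m]_(x in D) (g x)%:E < +oo)%E -> I h <= I k.
Proof.
move=> /measurable_EFinP mh /measurable_EFinP mk /measurable_EFinP mg hk kg goo.
have k0 x : D x -> 0 <= k x by move=> /hk /andP[]; exact: le_trans.
have le_hk : (\int[m]_(x in D) (h x)%:E <= \int[m]_(x in D) (k x)%:E)%E.
  by apply: ge0_le_integral => // x /hk /andP[]; rewrite lee_fin.
have le_kg : (\int[m]_(x in D) (k x)%:E <= \int[m]_(x in D) (g x)%:E)%E.
  by apply: ge0_le_integral => // x Dx; rewrite lee_fin ?k0 ?kg.
have koo := le_lt_trans le_kg goo.
apply: fine_le => //; rewrite ge0_fin_numE//.
- exact: le_lt_trans koo.
- by apply: integral_ge0 => x /hk /andP[]; rewrite lee_fin.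
- by apply: integral_ge0 => x /k0; rewrite lee_fin.
Qed.

Lemma fine_integralZl c h : measurable_fun D h -> (forall x, D x -> 0 <= h x) ->
  0 <= c -> I (fun x => c * h x) = c * I h.
Proof.
move=> /measurable_EFinP mh h0 c0; rewrite /I.
under eq_integral do rewrite EFinM.
rewrite ge0_integralZl//; case: (\int[m]_(x in D) (h x)%:E)%E => [s| |] //=;
  have [->|cneq0] := eqVneq c 0; rewrite ?mul0e ?mul0r ?mulr0//.
- by rewrite gt0_muley// lte_fin lt_neqAle eq_sym cneq0.
- by rewrite gt0_muleNy// lte_fin lt_neqAle eq_sym cneq0.
Qed.

Lemma fine_integral_small (h : nat -> T -> R) g e : 0 < e ->
  (forall n, measurable_fun D (h n)) -> measurable_fun D g ->
  (forall n x, D x -> 0 <= h n x <= g x) ->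
  (forall x, D x -> h n x @[n --> \oo] --> 0) ->
  (\int[m]_(x in D) (g x)%:E < +oo)%E -> exists n, I (h n) <= e.
Proof.
move=> e0 mh mg hg h_cvg0 goo.
have ig : m.-integrable D (EFin \o g).
  apply/integrableP; split; first exact/measurable_EFinP.
  apply: le_lt_trans goo; apply: ge0_le_integral => //.
  - by apply: measurableT_comp => //; exact/measurable_EFinP.
  - exact/measurable_EFinP.
  - move=> x Dx; rewrite /= lee_fin ger0_norm//.
    by have /andP[] := hg 0%N x Dx; exact: le_trans.
have [||||_ _] := @dominated_convergence _ _ _ m D mD
  (fun n => EFin \o h n) (cst 0%E) (EFin \o g) _ _ _ ig _.
- by move=> n; exact/measurable_EFinP.
- by apply: measurable_cst.
- apply: aeW => x Dx; apply: cvg_EFin; last exact: h_cvg0.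
  by near=> n.
- apply: aeW => x n Dx; rewrite /= lee_fin.
  by have /andP[h0 hle] := hg n x Dx; rewrite ger0_norm.
rewrite integral0 => /fine_cvgP[_ /cvgr_lt /(_ e e0)] [n _ /(_ n (leqnn n)) hn].
by exists n; exact: ltW.
Unshelve. all: by end_near. Qed.

End real_integrals.

(** * The integrands of the two mechanisms *)

Section exponential_kernels.
Context {R : realType}.
Implicit Types (x y q u t : R).

Definition expk1 x : R := 1 - expR (- x).
Definition expk2 x : R := expR (- x) - 1 + x.

Lemma expk1_le x y : x <= y -> expk1 x <= expk1 y.
Proof. by move=> xy; rewrite lerD2l lerN2 ler_expR lerN2. Qed.

Lemma expk1_ge0 x : 0 <= x -> 0 <= expk1 x.
Proof. by move=> x0; rewrite subr_ge0 -expR0 ler_expR oppr_le0. Qed.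

Lemma expk1_le_id x : expk1 x <= x.
Proof. by have := expR_ge1Dx (- x); rewrite /expk1; lra. Qed.

Lemma expk1_le_min q u : 0 <= q -> 0 <= u -> expk1 (q * u) <= (1 + q) * Num.min 1 u.
Proof.
move=> q0 u0; have e0 := expR_ge0 (- (q * u)); have := expk1_le_id (q * u).
rewrite /expk1; case: (leP 1 u) => u1; nra.
Qed.

Lemma expk2_ge0 x : 0 <= expk2 x.
Proof. by have := expR_ge1Dx (- x); rewrite /expk2; lra. Qed.

(** With [h = y - x], [exp(- h) >= 1 - h] makes the increment at least [h (1 - exp(- x))]. *)
Lemma expk2_le x y : 0 <= x -> x <= y -> expk2 x <= expk2 y.
Proof.
move=> x0 xy; rewrite /expk2.
have -> : expR (- y) = expR (- x) * expR (- (y - x)).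
  by rewrite -expRD; congr expR; ring.
have := expR_ge1Dx (- (y - x)); have := expR_ge0 (- x).
have : expR (- x) <= 1 by rewrite -expR0 ler_expR oppr_le0.
nra.
Qed.

Lemma expk2_le_id x : 0 <= x -> expk2 x <= x.
Proof.
move=> x0; have : expR (- x) <= 1 by rewrite -expR0 ler_expR oppr_le0.
rewrite /expk2; lra.
Qed.

(** From [exp(- x) <= 1 / (1 + x)], the left side is at most [x ^ 2 / (1 + x)]. *)
Lemma expk2_le_sqr x : 0 <= x -> expk2 x <= x ^+ 2.
Proof.
move=> x0; have x1 : 0 < 1 + x by rewrite ltr_wpDr.
have : expR (- x) <= (1 + x)^-1.
  by rewrite expRN lef_pV2 ?posrE ?expR_gt0//; exact: expR_ge1Dx.
have : (1 + x)^-1 * (1 + x) = 1 by rewrite mulVf// gt_eqF.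
have : 0 < (1 + x)^-1 by rewrite invr_gt0.
rewrite /expk2; nra.
Qed.

Lemma expk2_le_min q u : 0 <= q -> 0 <= u ->
  expk2 (q * u) <= (q + q ^+ 2) * Num.min u (u ^+ 2).
Proof.
move=> q0 u0; have qu0 : 0 <= q * u by exact: mulr_ge0.
have := expk2_le_id qu0; have := expk2_le_sqr qu0.
rewrite exprMn; case: (leP u (u ^+ 2)) => _ h1 h2.
  apply: le_trans h2 _; rewrite ler_wpM2r// lerDl; exact: sqr_ge0.
by apply: le_trans h1 _; rewrite ler_wpM2r ?sqr_ge0// lerDr.
Qed.

(** Convexity of [exp] between [- x] and [0]. *)
Lemma expk2_convex t x : 0 <= t -> t <= 1 -> expk2 (t * x) <= t * expk2 x.
Proof.
move=> t0 t1.
have := convex_expR (Itv01 t0 t1) (- x) 0.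
rewrite !convRE /= expR0 mulr0 addr0 mulr1 mulrN /unstable.onem /expk2.
lra.
Qed.

End exponential_kernels.

(** * Monotonicity and behaviour at [0] of [Psi] and [Phi] *)

Section mechanisms.
Context {R : realType} (sigma b beta : R) (pi nu : {measure set R -> \bar R}).
Implicit Types (x y q u e delta : R).
Hypothesis beta_ge0 : 0 <= beta.
Hypothesis pi_int : (\int[pi]_(z in Rpos) (Num.min z (z ^+ 2))%:E < +oo)%E.
Hypothesis nu_int : (\int[nu]_(z in Rpos) (Num.min 1 z)%:E < +oo)%E.

Let mRpos : measurable (Rpos : set R).
Proof. exact: measurable_itv. Qed.

Let Rpos_gt0 u : Rpos u -> 0 < u.
Proof. by rewrite /Rpos/= in_itv/= andbT. Qed.

Let measurable_expNM q : measurable_fun Rpos (fun u => expR (- (q * u))).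
Proof.
apply: measurable_funTS; apply: measurableT_comp => //.
by apply: measurableT_comp => //; exact: mulrl_measurable.
Qed.

Let measurable_expk1 q : measurable_fun Rpos (fun u => expk1 (q * u)).
Proof. by apply: measurable_funB. Qed.

Let measurable_expk2 q : measurable_fun Rpos (fun u => expk2 (q * u)).
Proof.
apply: measurable_funD; first exact: measurable_funB.
by apply: measurable_funTS; exact: mulrl_measurable.
Qed.

Let measurable_min1 : measurable_fun Rpos (fun z : R => Num.min 1 z).
Proof. by apply: measurable_funTS; exact: measurable_minr. Qed.

Let measurable_min2 : measurable_fun Rpos (fun z : R => Num.min z (z ^+ 2)).
Proof.
by apply: measurable_funTS; apply: measurable_minr => //; exact: exprn_measurable.
Qed.

Let scaled_finite (m : {measure set R -> \bar R}) (g : R -> R) c :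
  measurable_fun Rpos g -> (forall u, Rpos u -> 0 <= g u) -> 0 <= c ->
  (\int[m]_(z in Rpos) (g z)%:E < +oo)%E ->
  (\int[m]_(z in Rpos) (c * g z)%:E < +oo)%E.
Proof.
move=> /measurable_EFinP mg g0 c0 goo.
under eq_integral do rewrite EFinM.
by rewrite ge0_integralZl// lte_mul_pinfty.
Qed.

Let min1_ge0 u : Rpos u -> 0 <= Num.min 1 u.
Proof. by move=> /Rpos_gt0 /ltW u0; rewrite le_min ler01. Qed.

Let min2_ge0 u : Rpos u -> 0 <= Num.min u (u ^+ 2).
Proof. by move=> /Rpos_gt0 /ltW u0; rewrite le_min u0 sqr_ge0. Qed.

Lemma immigrationE q :
  immigration beta nu q = beta * q + fine (\int[nu]_(u in Rpos) (expk1 (q * u))%:E)%E.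
Proof. by []. Qed.

Lemma branchingE q : branching sigma b pi q = b * q + sigma ^+ 2 * q ^+ 2 / 2
  + fine (\int[pi]_(u in Rpos) (expk2 (q * u))%:E)%E.
Proof. by []. Qed.

Let fine_expk1_le x y : 0 <= x -> x <= y ->
  fine (\int[nu]_(u in Rpos) (expk1 (x * u))%:E)%E <=
  fine (\int[nu]_(u in Rpos) (expk1 (y * u))%:E)%E.
Proof.
move=> x0 xy; have y0 := le_trans x0 xy.
apply: (fine_integral_le mRpos (g := fun u => (1 + y) * Num.min 1 u)) => //.
- by apply: measurable_funM => //; exact: measurable_cst.
- move=> u /Rpos_gt0 /ltW u0; rewrite expk1_ge0 ?mulr_ge0//=.
  by apply: expk1_le; rewrite ler_wpM2r.
- by move=> u /Rpos_gt0 /ltW u0; exact: expk1_le_min.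
- by apply: scaled_finite => //; rewrite addr_ge0.
Qed.

Lemma immigration0 : immigration beta nu 0 = 0.
Proof.
rewrite immigrationE mulr0 add0r; under eq_integral do rewrite mul0r /expk1 oppr0 expR0 subrr.
by rewrite integral0.
Qed.

Lemma immigration_le x y : 0 <= x -> x <= y ->
  immigration beta nu x <= immigration beta nu y.
Proof. move=> x0 xy; rewrite !immigrationE; apply: lerD; first exact: ler_wpM2l.
exact: fine_expk1_le. Qed.

Let cvg_scaled_harmonic c : c * n.+1%:R^-1 @[n --> \oo] --> (0 : R).
Proof. by rewrite -[0](mulr0 c); apply: cvgMr; exact: cvg_harmonic. Qed.

(** Dominated convergence along [q = 1 / (n + 1)], then monotonicity in [q]. *)
Lemma immigration_small e : 0 < e ->
  exists2 delta, 0 < delta & immigration beta nu delta <= e.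
Proof.
move=> e0; have e20 : 0 < e / 2 by rewrite divr_gt0.
have inv1 n : n.+1%:R^-1 <= 1 :> R by rewrite invf_le1// ler1n.
have [|||||n hn] := @fine_integral_small _ _ R nu Rpos mRpos
  (fun n u => expk1 (n.+1%:R^-1 * u)) (fun u => 2 * Num.min 1 u) (e / 2) e20 _ _ _ _ _.
- by move=> n; exact: measurable_expk1.
- by apply: measurable_funM => //; exact: measurable_cst.
- move=> n u Ru; have /ltW u0 := Rpos_gt0 Ru.
  rewrite expk1_ge0 ?mulr_ge0//=; apply: le_trans (expk1_le_min _ u0) _ => //.
  by rewrite ler_wpM2r ?min1_ge0// (_ : 2 = 1 + 1)// lerD2l.
- move=> u /Rpos_gt0 /ltW u0.
  apply: (squeeze_cvgr _ (cvg_cst 0) (cvg_scaled_harmonic u)).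
  by near=> n; rewrite expk1_ge0 ?mulr_ge0//= mulrC expk1_le_id.
- exact: scaled_finite.
pose delta := Num.min n.+1%:R^-1 (e / 2 / (beta + 1)).
have b1 : 0 < beta + 1 by rewrite ltr_wpDl.
have delta0 : 0 < delta by rewrite lt_min invr_gt0 ltr0n/= divr_gt0.
exists delta; [exact: delta0|rewrite immigrationE [e]splitr; apply: lerD].
  apply: (@le_trans _ _ (beta * (e / 2 / (beta + 1)))).
    by rewrite ler_wpM2l// ge_min lexx orbT.
  by rewrite mulrA ler_pdivrMr// mulrDr mulr1 mulrC lerDl ltW.
by apply: le_trans hn; apply: fine_expk1_le; [exact: ltW|rewrite ge_min lexx].
Unshelve. all: by end_near. Qed.

Lemma branching0 : branching sigma b pi 0 = 0.
Proof.
rewrite branchingE expr0n/= !mulr0 mul0r !add0r.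
under eq_integral do rewrite mul0r /expk2 oppr0 expR0 subrr addr0.
by rewrite integral0.
Qed.

Lemma branching_incr x y : 0 <= x -> x <= y ->
  b * (y - x) <= branching sigma b pi y - branching sigma b pi x.
Proof.
move=> x0 xy; have y0 := le_trans x0 xy.
have : fine (\int[pi]_(u in Rpos) (expk2 (x * u))%:E)%E <=
       fine (\int[pi]_(u in Rpos) (expk2 (y * u))%:E)%E.
  apply: (fine_integral_le mRpos (g := fun u => (y + y ^+ 2) * Num.min u (u ^+ 2))) => //.
  - by apply: measurable_funM => //; exact: measurable_cst.
  - move=> u /Rpos_gt0 /ltW u0; rewrite expk2_ge0/=.
    by apply: expk2_le; rewrite ?mulr_ge0// ler_wpM2r.
  - by move=> u /Rpos_gt0 /ltW u0; exact: expk2_le_min.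
  - by apply: scaled_finite => //; rewrite addr_ge0// sqr_ge0.
have : sigma ^+ 2 * x ^+ 2 <= sigma ^+ 2 * y ^+ 2.
  by rewrite ler_wpM2l ?sqr_ge0// ler_sqr ?nnegrE.
rewrite !branchingE; lra.
Qed.

(** By dominated convergence the integral of [(n + 1) expk2(u / (n + 1))] is at most [e / 2] for
    some [n]. Convexity bounds [expk2(q u)] by [q] times this integrand for all
    [q <= 1 / (n + 1)]. *)
Lemma branching_le e : 0 < e -> exists2 delta, 0 < delta &
  forall q, 0 <= q -> q <= delta -> branching sigma b pi q <= (b + e) * q.
Proof.
move=> e0; have e20 : 0 < e / 2 by rewrite divr_gt0.
have inv1 n : n.+1%:R^-1 <= 1 :> R by rewrite invf_le1// ler1n.
have inv0 n : 0 <= n.+1%:R^-1 :> R by [].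
have [|||||n hn] := @fine_integral_small _ _ R pi Rpos mRpos
  (fun n u => n.+1%:R * expk2 (n.+1%:R^-1 * u))
  (fun u => 2 * Num.min u (u ^+ 2)) (e / 2) e20 _ _ _ _ _.
- by move=> n; apply: measurable_funM; [exact: measurable_cst|exact: measurable_expk2].
- by apply: measurable_funM => //; exact: measurable_cst.
- move=> n u Ru; have /ltW u0 := Rpos_gt0 Ru.
  rewrite mulr_ge0 ?expk2_ge0//=.
  rewrite mulrC -ler_pdivlMr ?ltr0n//.
  (* The constant [2] bounds [(n + 1) (1 / (n + 1) + 1 / (n + 1) ^ 2) = 1 + 1 / (n + 1)]. *)
  apply: le_trans (expk2_le_min (inv0 n) u0) _.
  rewrite mulrAC ler_wpM2r ?min2_ge0// expr2 [2 * _]mulrC mulrDr mulr1 lerD2l.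
  by rewrite ler_piMr.
- move=> u /Rpos_gt0 /ltW u0.
  apply: (squeeze_cvgr _ (cvg_cst 0) (cvg_scaled_harmonic (u ^+ 2))).
  near=> n; rewrite mulr_ge0 ?expk2_ge0//= mulrC -ler_pdivlMr ?ltr0n//.
  apply: le_trans (expk2_le_sqr _) _; first by rewrite mulr_ge0.
  by rewrite exprMn expr2 mulrC mulrA.
- exact: scaled_finite.
(* The second bound leaves the quadratic term at most [q e / 2]. *)
pose delta := Num.min n.+1%:R^-1 (e / (sigma ^+ 2 + 1)).
have s1 : 0 < sigma ^+ 2 + 1 by rewrite ltr_wpDl ?sqr_ge0.
exists delta; first by rewrite lt_min invr_gt0 ltr0n/= divr_gt0.
move=> q q0; rewrite le_min => /andP[qn qe].
have sq : sigma ^+ 2 * q <= e.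
  move: qe; rewrite ler_pdivlMr//; nra.
have : fine (\int[pi]_(u in Rpos) (expk2 (q * u))%:E)%E <= q * (e / 2).
  apply: (@le_trans _ _ (fine (\int[pi]_(u in Rpos)
      (q * (n.+1%:R * expk2 (n.+1%:R^-1 * u)))%:E)%E)); last first.
    rewrite fine_integralZl//.
    + by rewrite ler_wpM2l.
    + by apply: measurable_funM; [exact: measurable_cst|exact: measurable_expk2].
    + by move=> u _; rewrite mulr_ge0 ?expk2_ge0.
  apply: (fine_integral_le mRpos (g := fun u =>
      (q * n.+1%:R * (n.+1%:R^-1 + n.+1%:R^-1 ^+ 2)) * Num.min u (u ^+ 2))) => //.
  - apply: measurable_funM; first exact: measurable_cst.
    by apply: measurable_funM; [exact: measurable_cst|exact: measurable_expk2].
  - by apply: measurable_funM => //; exact: measurable_cst.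
  - move=> u /Rpos_gt0 /ltW u0; rewrite expk2_ge0/= mulrA.
    have -> : q * u = (q * n.+1%:R) * (n.+1%:R^-1 * u).
      by rewrite mulrA -[q * _ * _]mulrA mulfV ?mulr1// gt_eqF.
    apply: expk2_convex; first by rewrite mulr_ge0.
    by rewrite -ler_pdivlMr// div1r.
  - move=> u /Rpos_gt0 /ltW u0; rewrite -!mulrA ler_wpM2l// ler_wpM2l//.
    by rewrite expk2_le_min.
  - by apply: scaled_finite => //; rewrite !mulr_ge0// addr_ge0 ?sqr_ge0.
rewrite branchingE.
have : sigma ^+ 2 * q ^+ 2 / 2 <= q * (e / 2) by rewrite expr2; nra.
lra.
Unshelve. all: by end_near. Qed.

End mechanisms.

Theorem theorem4 (R : realType) (sigma b beta : R)
  (pi nu : {measure set R -> \bar R}) (v : R -> R -> R) :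
  0 <= sigma -> 0 <= beta ->
  pi `]-oo, 0]%classic = 0%E -> sigma_finite Rpos pi ->
  (\int[pi]_(z in Rpos) (Num.min z (z ^+ 2))%:E < +oo)%E ->
  nu `]-oo, 0]%classic = 0%E -> sigma_finite Rpos nu ->
  (\int[nu]_(z in Rpos) (Num.min 1 z)%:E < +oo)%E ->
  (forall q, 0 < q -> 0 < immigration beta nu q) ->
  solves_v (branching sigma b pi) v ->
  b != 0 ->
  (forall eps : R, 0 < eps ->
     (\int[lebesgue_measure]_(u in `]0%R, eps[)
        (immigration beta nu u / `|branching sigma b pi u|)%:E = +oo)%E) ->
  forall (x : R), 0 <= x ->
  forall (d : measure_display) (T : measurableType d) (P : probability T R)
         (Y : R -> T -> R),
  is_CBI P (branching sigma b pi) (immigration beta nu) v x Y ->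
  cvg_in_distribution P
    (fun t w => r_inv (immigration beta nu) v t (Y t w))
    (exponential_prob 1).
Proof.
move=> _ beta0 _ _ pi_int _ _ nu_int Phi_gt0 v_solves b_neq0 Phi_Psi_infty x x0
  d T P Y CBI.
apply: (r_inv_cvg_exponential _ _ _ _ Phi_gt0 _ _ b_neq0 v_solves Phi_Psi_infty x0 CBI).
- exact: branching_incr.
- exact: branching0.
- exact: branching_le.
- exact: immigration_le.
- exact: immigration_small.
- exact: immigration0.
Qed.
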